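(* Let $K\ge1$ be fixed and consider a linear $K$-parametric minimization problem whose instances satisfy Assumptions (a)–(c) listed in the context. If either a polynomial-time exact algorithm $\mathrm{ALG}_1$ or an FPTAS is available for the non-parametric version of the problem, then the grid algorithm described in the context (using the available non-parametric algorithm(s) as subroutine) yields an FPTAS for the $K$-parametric problem. If a PTAS is available for the non-parametric version, then the grid algorithm yields a PTAS for the $K$-parametric problem.
   Context: Problem. An instance $\Pi$ of a linear $K$-parametric (minimization) problem is given by a nonempty set $X$ of feasible solutions, functions $a,b_1,\dots,b_K:X\to\mathbb{R}$ and a parameter set $\Lambda\subseteq\mathbb{R}^K$. For $x\in X$, $\lambda\in\Lambda$ put $f(x,\lambda)=a(x)+\sum_{k=1}^K\lambda_k b_k(x)$. For fixed $\lambda\in\Lambda$, the non-parametric problem $\Pi(\lambda)$ is $\inf_{x\in X}f(x,\lambda)$. Assumptions. (a) $\Lambda=\prod_{k=1}^K[\lambda^{\min}_k,\infty)$ for a given $\lambda^{\min}\in\mathbb{R}^K$. (b) Every $x\in X$ has encoding length polynomial in the instance size, and $a(x),b_k(x)$ can be computed in time polynomial in the instance size and the encoding length of $x$. (c) Positive rationals $\mathrm{LB}\le\mathrm{UB}$ with $b_k(x),f(x,\lambda^{\min})\in\{0\}\cup[\mathrm{LB},\mathrm{UB}]$ for all $x\in X$, $k=1,\dots,K$, can be computed in time polynomial in the instance size. Non-parametric algorithms. For $\alpha\ge1$, $\mathrm{ALG}_\alpha$ denotes an algorithm that returns, for any $\lambda\in\Lambda$, a solution $x'\in X$ with $f(x',\lambda)\le\alpha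 f(x,\lambda)$ for all $x\in X$ (so $\mathrm{ALG}_1$ is exact). A PTAS for the non-parametric version is a family $(\mathrm{ALG}_{1+\delta})_{\delta>0}$ of such algorithms, each running in polynomial time; it is an FPTAS if the running time is in addition polynomial in $1/\delta$. Approximation of the parametric problem. For $\beta\ge1$, a finite set $S\subseteq X$ is a $\beta$-approximation set for $\Pi$ if for every $\lambda\in\Lambda$ there is $x\in S$ with $f(x,\lambda)\le\beta f(x',\lambda)$ for all $x'\in X$. A $\beta$-approximation algorithm computes a $\beta$-approximation set for every instance in time polynomial in the instance size. A PTAS for the parametric problem is a family $(\mathcal{A}_\varepsilon)_{\varepsilon>0}$ such that each $\mathcal{A}_\varepsilon$ is a $(1+\varepsilon)$-approximation algorithm; it is an FPTAS if the running time of $\mathcal{A}_\varepsilon$ is in addition polynomial in $1/\varepsilon$. ($K$ is a constant.) Grid algorithm with accuracy $\varepsilon\in(0,1)$ and subroutine $\mathrm{ALG}_\alpha$. Compute $\mathrm{LB},\mathrm{UB}$; set $\varepsilon'=\varepsilon/2$, $\beta=(1+\varepsilon')\alpha$, $c=\frac{\varepsilon'\cdot\mathrm{LB}}{\beta\cdot\mathrm{UB}}$, $\mathrm{lb}=\left\lfloor\log_{1+\varepsilon/2}\frac{c^K}{(K+1)!}\right\rfloor$, $\mathrm{ub}=\left\lceil\log_{1+\varepsilon/2}\frac{(K+1)!}{c^K}\right\rceil$. Starting with $S=\emptyset$, for all integer vectors $(i_1,\dots,i_K)$ with $\mathrm{lb}\le i_k\le\mathrm{ub}$ add to $S$ the solution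 returned by $\mathrm{ALG}_\alpha$ for $\lambda=\left(\lambda^{\min}_k+(1+\tfrac\varepsilon2)^{i_k}\right)_{k=1}^K$; return $S$. To obtain the schemes, for a target accuracy the grid algorithm may be run with suitable values of its accuracy parameter and of the accuracy of the subroutine. *)

(* Defs.v *)
From HB Require Import structures.
From mathcomp Require Import all_boot all_order all_algebra polyXY zify.
From mathcomp Require Import boolp classical_sets cardinality reals exp.
Set Implicit Arguments.
Unset Strict Implicit.
Unset Printing Implicit Defensive.
Import Order.TTheory GRing.Theory Num.Theory.
Local Open Scope classical_set_scope.
Local Open Scope ring_scope.

(* Inputs and outputs of algorithms are finite binary trees whose leaves are
   rationals.  Instances and solutions are identified with their encodings. *)
Inductive data : Type := Num of rat | Pair of data & data.

HB.instance Definition _ := gen_eqMixin data.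

Definition nbits (z : int) : nat := (trunc_log 2 `|z|%N).+1.

(* Encoding length.  The extra 1 at a leaf pays for the sign. *)
Fixpoint dsize (v : data) : nat :=
  match v with
  | Num q => (nbits (numq q) + nbits (denq q)).+1
  | Pair v1 v2 => (dsize v1 + dsize v2).+1
  end.

Fixpoint dlist (s : seq data) : data :=
  if s is v :: s' then Pair v (dlist s') else Num 0.

Definition dvec K (q : 'rV[rat]_K) : data :=
  dlist [seq Num (q 0 k) | k <- enum 'I_K].

Inductive prim : Type :=
  | PId | PConst of data
  | PFst | PSnd | PIsNum
  | PAdd | POpp | PMul | PInv | PFloor | PLe.

Definition prim_step (o : prim) (v : data) : option data :=
  match o, v with
  | PId, _ => Some v
  | PConst c, _ => Some c
  | PFst, Pair v1 _ => Some v1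
  | PSnd, Pair _ v2 => Some v2
  | PIsNum, Num _ => Some (Num 1)
  | PIsNum, Pair _ _ => Some (Num 0)
  | PAdd, Pair (Num a) (Num b) => Some (Num (a + b))
  | POpp, Num a => Some (Num (- a))
  | PMul, Pair (Num a) (Num b) => Some (Num (a * b))
  | PInv, Num a => Some (Num a^-1)
  | PFloor, Num a => Some (Num (Num.floor a)%:~R)
  | PLe, Pair (Num a) (Num b) => Some (Num (a <= b)%R%:R)
  | _, _ => None
  end.

Inductive program : Type :=
  | Prim of prim
  | Seq of program & program
  | Fork of program & program
  | If of program & program & program
  | While of program & program.

(* [run A v w t]: on input v, A halts with output w after time t.  A primitive
   costs the encoding length of its input and output.  The primitives are
   computable in polynomial time on bit strings, and the length of every
   intermediate value is at most the running time, so the polynomial-time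
   functions are the usual ones. *)
Inductive run : program -> data -> data -> nat -> Prop :=
  | RunPrim o v w :
      prim_step o v = Some w -> run (Prim o) v w (dsize v + dsize w)
  | RunSeq A B u v w t1 t2 :
      run A u v t1 -> run B v w t2 -> run (Seq A B) u w (t1 + t2).+1
  | RunFork A B u v w t1 t2 :
      run A u v t1 -> run B u w t2 -> run (Fork A B) u (Pair v w) (t1 + t2).+1
  | RunIfTrue C A B u w b t1 t2 :
      run C u (Num b) t1 -> b != 0 -> run A u w t2 ->
      run (If C A B) u w (t1 + t2).+1
  | RunIfFalse C A B u w t1 t2 :
      run C u (Num 0) t1 -> run B u w t2 -> run (If C A B) u w (t1 + t2).+1
  | RunWhileStop C A u t :
      run C u (Num 0) t -> run (While C A) u u t.+1
  | RunWhileStep C A u v w b t1 t2 t3 :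
      run C u (Num b) t1 -> b != 0 -> run A u v t2 ->
      run (While C A) v w t3 -> run (While C A) u w (t1 + t2 + t3).+1.

Lemma run_size A v w t : run A v w t -> (dsize v <= t)%N /\ (dsize w <= t)%N.
Proof.
by elim=> {A v w t} /= *; repeat match goal with H : _ /\ _ |- _ => case: H => ? ? end;
  split; lia.
Qed.

Lemma run_det A v w1 w2 t1 t2 :
  run A v w1 t1 -> run A v w2 t2 -> w1 = w2 /\ t1 = t2.
Proof.
move=> H; elim: H w2 t2 => {A v w1 t1}
  [o v w E|A B u v w t1 t2 _ IH1 _ IH2|A B u v w t1 t2 _ IH1 _ IH2
  |C A B u w b t1 t2 _ IH1 b0 _ IH2|C A B u w t1 t2 _ IH1 _ IH2
  |C A u t _ IH1|C A u v w b t1 t2 t3 _ IH1 b0 _ IH2 _ IH3] w' t' H;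
  inversion H; subst;
  repeat match goal with
  | IH : (forall _ _, run ?A ?v _ _ -> _), H : run ?A ?v _ _ |- _ =>
      case: (IH _ _ H) => ? ?; clear IH; subst
  end; try (by split; congruence);
  match goal with
  | b0 : is_true (?b != 0), E : Num _ = Num _ |- _ =>
      by case: E b0 => ->; rewrite eqxx
  | b0 : is_true (?b != 0), E : Num _ = Num _ |- _ =>
      by case: E b0 => <-; rewrite eqxx
  end.
Qed.

Definition halts_with (A : program) (D : set data) (Q : data -> data -> Prop) :=
  forall v, D v -> exists w t, run A v w t /\ Q v w.

Definition time_bound (R : realType) (A : program) (D : set data)
    (T : data -> R) :=
  forall v w t, D v -> run A v w t -> t%:R <= T v.

Definition polytime (R : realType) (A : program) (D : set data) :=
  exists p : {poly R}, time_bound A D (fun v => p.[(dsize v)%:R]).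

Definition polytime_family (R : realType) (A : R -> program) (D : set data) :=
  exists p : {poly {poly R}}, forall e, 0 < e ->
    time_bound (A e) D (fun v => p.[(dsize v)%:R, e^-1]).

Record problem (R : realType) (K : nat) : Type := Problem {
  instance : set data;
  feasible : data -> set data;
  acoef : data -> data -> R;
  bcoef : data -> 'I_K -> data -> R;
  params : data -> set 'rV[R]_K;
  feasible_neq0 : forall I, instance I -> feasible I !=set0 }.

Definition objective (R : realType) K (P : problem R K) (I x : data)
    (l : 'rV[R]_K) : R :=
  acoef P I x + \sum_(k < K) l 0 k * bcoef P I k x.

Definition solution_inputs (R : realType) K (P : problem R K) : set data :=
  [set v | exists I x, [/\ v = Pair I x, instance P I & feasible P I x]].

(* That lmin is given means that its (rational) entries can be read off the
   instance in polynomial time. *)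
Definition assumption_a (R : realType) K (P : problem R K)
    (lmin : data -> 'rV[R]_K) : Prop :=
  (forall I, instance P I ->
     params P I = [set l | forall k, lmin I 0 k <= l 0 k]) /\
  (exists A, halts_with A (instance P)
       (fun I w => exists2 q, w = dvec q & map_mx ratr q = lmin I)
     /\ polytime R A (instance P)).

Definition assumption_b (R : realType) K (P : problem R K) : Prop :=
  [/\ exists p : {poly R}, forall I x, instance P I -> feasible P I x ->
        (dsize x)%:R <= p.[(dsize I)%:R],
      exists A, halts_with A (solution_inputs P)
          (fun v w => forall I x, v = Pair I x ->
             exists2 q, w = Num q & ratr q = acoef P I x)
        /\ polytime R A (solution_inputs P)
    & forall k, exists A, halts_with A (solution_inputs P)
          (fun v w => forall I x, v = Pair I x ->
             exists2 q, w = Num q & ratr q = bcoef P I k x)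
        /\ polytime R A (solution_inputs P)].

Definition zero_or_between (R : realType) (l u : rat) (y : R) :=
  y = 0 \/ ratr l <= y <= ratr u.

Definition assumption_c (R : realType) K (P : problem R K)
    (lmin : data -> 'rV[R]_K) (LB UB : data -> rat) : Prop :=
  (forall I, instance P I ->
     0 < LB I <= UB I /\
     forall x, feasible P I x ->
       zero_or_between (LB I) (UB I) (objective P I x (lmin I)) /\
       forall k, zero_or_between (LB I) (UB I) (bcoef P I k x)) /\
  (exists A, halts_with A (instance P)
       (fun I w => w = Pair (Num (LB I)) (Num (UB I)))
     /\ polytime R A (instance P)).

(* Programs only accept rational parameter vectors. *)
Definition nonparam_inputs (R : realType) K (P : problem R K) : set data :=
  [set v | exists I (q : 'rV[rat]_K),
     [/\ v = Pair I (dvec q), instance P I & params P I (map_mx ratr q)]].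

Definition nonparam_alg (R : realType) K (P : problem R K) (alpha : R)
    (A : program) :=
  halts_with A (nonparam_inputs P) (fun v x' =>
    forall I (q : 'rV[rat]_K), v = Pair I (dvec q) ->
      feasible P I x' /\ forall x, feasible P I x ->
        objective P I x' (map_mx ratr q) <=
        alpha * objective P I x (map_mx ratr q)).

Definition nonparam_exact (R : realType) K (P : problem R K) (A : program) :=
  nonparam_alg P 1 A /\ polytime R A (nonparam_inputs P).

Definition nonparam_PTAS (R : realType) K (P : problem R K)
    (A : R -> program) :=
  forall d, 0 < d ->
    nonparam_alg P (1 + d) (A d) /\ polytime R (A d) (nonparam_inputs P).

Definition nonparam_FPTAS (R : realType) K (P : problem R K)
    (A : R -> program) :=
  nonparam_PTAS P A /\ polytime_family A (nonparam_inputs P).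

Definition approximation_set (R : realType) K (P : problem R K) (beta : R)
    (I : data) (S : set data) :=
  [/\ finite_set S, S `<=` feasible P I
    & forall l, params P I l -> exists2 x, S x &
        forall x', feasible P I x' ->
          objective P I x l <= beta * objective P I x' l].

Definition approximation_alg (R : realType) K (P : problem R K) (beta : R)
    (A : program) :=
  halts_with A (instance P) (fun I w => exists2 s : seq data,
      w = dlist s & approximation_set P beta I [set` s])
  /\ polytime R A (instance P).

Definition param_PTAS (R : realType) K (P : problem R K) (A : R -> program) :=
  forall e, 0 < e -> approximation_alg P (1 + e) (A e).

Definition param_FPTAS (R : realType) K (P : problem R K) (A : R -> program) :=
  param_PTAS P A /\ polytime_family A (instance P).

Section GridAlgorithm.
Variables (R : realType) (K : nat) (lmin : data -> 'rV[R]_K).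
Variables (LB UB : data -> rat) (eps : rat) (alpha : R) (ALG : program).

Definition logb (b x : R) : R := ln x / ln b.

Definition grid_beta : R := (1 + ratr eps / 2) * alpha.

Definition grid_c (I : data) : R :=
  (ratr eps / 2 * ratr (LB I)) / (grid_beta * ratr (UB I)).

Definition grid_lb (I : data) : int :=
  Num.floor (logb (1 + ratr eps / 2) (grid_c I ^+ K / K.+1`!%:R)).

Definition grid_ub (I : data) : int :=
  Num.ceil (logb (1 + ratr eps / 2) (K.+1`!%:R / grid_c I ^+ K)).

Definition grid_point (I : data) (i : 'I_K -> int) : 'rV[R]_K :=
  \row_k (lmin I 0 k + (1 + ratr eps / 2) ^ i k).

(* On inputs covered by the assumptions, every grid point is rational, so ALG
   is indeed called, and returns, at each of them. *)
Definition grid_output (I : data) : set data :=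
  [set x | exists i : 'I_K -> int,
     (forall k, (grid_lb I <= i k <= grid_ub I)%R) /\
     exists (q : 'rV[rat]_K) (t : nat),
       map_mx ratr q = grid_point I i /\ run ALG (Pair I (dvec q)) x t].

End GridAlgorithm.

(* G is the grid algorithm with accuracy eps in (0,1) and subroutine
   ALG = ALG_alpha: its output lists the solutions that ALG returns on the
   grid. *)
Definition is_grid_algorithm (R : realType) K (P : problem R K)
    (lmin : data -> 'rV[R]_K) (LB UB : data -> rat)
    (eps : rat) (alpha : R) (ALG G : program) :=
  0 < eps < 1 /\
  halts_with G (instance P) (fun I w => exists2 s : seq data,
    w = dlist s & [set` s] = grid_output lmin LB UB eps alpha ALG I).

(* Main.v *)
Require Import Defs.
From HB Require Import structures.
From mathcomp Require Import all_boot all_order all_algebra polyXY.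
From mathcomp Require Import boolp classical_sets cardinality reals exp.
From mathcomp Require Import zify ring lra.
Set Implicit Arguments.
Unset Strict Implicit.
Unset Printing Implicit Defensive.
Import Order.TTheory GRing.Theory Num.Theory.
Local Open Scope ring_scope.

(* Shift the parameters by lmin and write the objective as the sum of K+1
   nonnegative terms w_i Y_i, with w_0 = 1.  Any weight vector w factors as
   w_i = s_i l_i such that the l_i lie within a factor K! / c^K of each other,
   while each level of s dominates all lower levels taken together:
   sum of the l_k with s_k < s_j is at most c l_j.  If x is nearly optimal for
   the weights l, then it is nearly optimal for w: for a competitor y, let m be
   the highest level on which some Y_i(y) is nonzero; near-optimality for l
   forces Y_i(x) = 0 above m, and below m everything is dominated.  After
   division by l_0, the weights l lie in the box covered by the grid, and
   rounding them up to the grid costs a factor 1 + eps/2.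

   On the algorithmic side ub = - lb, so the powers of 1 + eps/2 with exponents
   in [lb, ub] are found by multiplying until (K+1)!/c^K, a rational number, is
   reached; this takes O(log((K+1)!/c^K) / eps) rounds.  With target accuracy e
   take n = floor(3/e) + 2 and eps = delta = 1/n, as
   (1 + 1/n)^2 <= 1 + 3/n <= 1 + e. *)

(** * Compactification of the weights *)

Section Compactification.
Variables (R : realFieldType) (J : finType).

(** Induction on the size of [A]: remove an index [p] of largest weight, rescale the rest, then
    place [p] on the top level or on a new level above it. Each step costs a factor [#|B| / c] in
    the ratio of the [l i], whence the factorial over a power of [c]. *)
Lemma separated_rescaling (c : R) (w : J -> R) (A : {set J}) :
  0 < c -> c <= 1 -> (forall i, 0 <= w i) -> A != finset.set0 ->
  exists l s : J -> R,
    [/\ forall i, i \in A -> [/\ 0 < l i, 0 <= s i & w i = s i * l i],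
        forall j, j \in A -> \sum_(k in A | s k < s j) l k <= c * l j
      & forall i j, i \in A -> j \in A ->
          l i <= #|A|.-1`!%:R / c ^+ #|A|.-1 * l j].
Proof.
move=> c0 c1 w0; move: {2}#|A| (leqnn #|A|) => n.
elim: n A => [|n IHn] A.
  by rewrite leqn0 cards_eq0 => /eqP ->; rewrite eqxx.
move=> cA An0; have /finset.set0Pn[i0 i0A] := An0.
pose p := [arg max_(i > i0 in A) w i]%O.
have [pA pmax] : p \in A /\ forall i, i \in A -> w i <= w p.
  by rewrite /p; case: arg_maxP.
pose B := A :\ p.
have AB : #|A| = #|B|.+1 by rewrite (cardsD1 p A) pA.
have [B0|Bn0] := eqVneq B finset.set0.
  have Ap i : i \in A -> i = p.
    by move=> iA; apply/eqP; apply: contraT => ip; rewrite -(finset.in_set0 i) -B0 !inE ip iA.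
  exists (fun=> 1), w; split.
  - by move=> i _; split; rewrite ?ltr01 ?mulr1.
  - move=> j /Ap ->; rewrite big_pred0 ?mulr1 ?ltW // => k.
    by apply/andP => -[/Ap ->]; rewrite ltxx.
  - by move=> i j _ _; rewrite AB B0 cards0 /= fact0 expr0 divr1 mulr1.
have cB : (#|B| <= n)%N by rewrite -ltnS -AB.
have [l [s [lsP gap ratio]]] := IHn B cB Bn0.
have Bgt0 : (0 < #|B|)%N by rewrite card_gt0.
have /finset.set0Pn[b0 b0B] := Bn0.
(* [j1] lies on the top level of [B], and [j2] carries the largest rescaled weight, so [#|B| * l j2]
   bounds the sum of [l] over [B]. *)
pose j1 := [arg max_(i > b0 in B) s i]%O.
have [j1B s1] : j1 \in B /\ forall i, i \in B -> s i <= s j1.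
  by rewrite /j1; case: arg_maxP.
pose j2 := [arg max_(i > b0 in B) l i]%O.
have [j2B l2] : j2 \in B /\ forall i, i \in B -> l i <= l j2.
  by rewrite /j2; case: arg_maxP.
have lgt0 i : i \in B -> 0 < l i by move=> /lsP[].
have sge0 i : i \in B -> 0 <= s i by move=> /lsP[].
have BA i : i \in B -> i \in A by rewrite !inE => /andP[].
have nBgt0 : 0 < #|B|%:R :> R by rewrite ltr0n.
have nB1 : 1 <= #|B|%:R :> R by rewrite ler1n.
have cut : l j2 <= #|B|%:R / c * l j2.
  rewrite ler_peMl //; first exact/ltW/lgt0.
  by rewrite ler_pdivlMr // mul1r (le_trans c1).
(* The largest weight joins the top level if that keeps the ratios bounded;
   otherwise it opens a new level, at the least value dominating the others. *)
pose tight := (0 < s j1) && (w p / s j1 <= #|B|%:R / c * l j2).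
pose lp := if tight then w p / s j1 else #|B|%:R / c * l j2.
pose sp := if tight then s j1 else w p / lp.
have lpU : lp <= #|B|%:R / c * l j2 by rewrite /lp; case: ifP => // /andP[].
(* Maximality of [w p] gives [l j1 <= lp] when [p] joins the top level; comparison with [j1] then
   bounds the ratio of any [l i] to [lp]. *)
have w1 : s j1 * l j1 <= w p by case: (lsP _ j1B) => _ _ <-; exact/pmax/BA.
have lpL : l j1 <= lp.
  rewrite /lp; case: ifP => [/andP[s1_gt0 _]|_].
    by rewrite ler_pdivlMr // mulrC.
  exact: le_trans (l2 _ j1B) cut.
have lp0 : 0 < lp by apply: lt_le_trans lpL; apply: lgt0.
have [sp0 wp] : 0 <= sp /\ w p = sp * lp.
  rewrite /sp; case: ifP => [t|_]; last by rewrite divfK ?gt_eqF // divr_ge0 // ltW.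
  rewrite /lp t; case/andP: t => s1_gt0 _.
  by rewrite [s j1 * _]mulrC divfK ?gt_eqF // ltW.
(* [p] ends up on the highest level, so it never enters the sums that the other indices must
   dominate. *)
have sps : s j1 <= sp.
  rewrite /sp; case: ifP => // /negbT; rewrite negb_and -leNgt -ltNge => /orP[s10|lt].
    by apply: le_trans s10 _; rewrite divr_ge0 // ltW.
  rewrite ler_pdivlMr //; have [s10|s10] := leP (s j1) 0.
    by apply: le_trans (w0 p); rewrite mulr_le0_ge0 // ltW.
  by rewrite mulrC -ler_pdivlMr // (le_trans lpU) // ltW.
have sumA (F : J -> R) (Q : pred J) : \sum_(k in A | Q k) F k =
    (if Q p then F p else 0) + \sum_(k in B | Q k) F k.
  rewrite (bigID (pred1 p)) /=; congr (_ + _).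
    case: ifP => Qp.
      rewrite (big_pred1 p) // => k /=; case: eqVneq => [->|]; rewrite ?andbF //.
      by rewrite pA Qp.
    rewrite big1 // => k /andP[/andP[_ Qk] /eqP kp]; by rewrite kp Qp in Qk.
  by apply: eq_bigl => k; rewrite !inE; case: (k == p); case: (k \in A); rewrite ?andbF ?andbT.
have cBn0 : c ^+ #|B| != 0 by rewrite expf_neq0 // gt_eqF.
have fB : (#|B|)`!%:R / c ^+ #|B| = #|B|%:R / c * (#|B|.-1`!%:R / c ^+ #|B|.-1) :> R.
  case: #|B| Bgt0 => // m _ /=; rewrite factS exprS.
  by rewrite natrM; field; rewrite expf_neq0 ?gt_eqF.
have fB1 : 1 <= #|B|.-1`!%:R / c ^+ #|B|.-1 :> R.
  rewrite ler_pdivlMr ?exprn_gt0 // mul1r.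
  apply: le_trans (exprn_ile1 _ (ltW c0) c1) _.
  by rewrite ler1n fact_gt0.
have fBle : #|B|.-1`!%:R / c ^+ #|B|.-1 <= (#|B|)`!%:R / c ^+ #|B| :> R.
  rewrite fB ler_peMl //; first by rewrite (le_trans ler01).
  by rewrite ler_pdivlMr // mul1r (le_trans c1).
exists (fun i => if i == p then lp else l i), (fun i => if i == p then sp else s i).
have inB i : i \in A -> i != p -> i \in B by rewrite !inE => -> ->.
split.
- move=> i iA; case: (eqVneq i p) => [->|ip]; [by [] | exact/lsP/inB].
- move=> j jA; rewrite sumA eqxx.
  have [_|jp] := eqVneq j p.
    rewrite ltxx add0r.
    have -> : \sum_(k in B | (if k == p then sp else s k) < sp)
        (if k == p then lp else l k) = \sum_(k in B | s k < sp) l k.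
      have nkp k : k \in B -> (k == p) = false by rewrite !inE => /andP[/negbTE].
      rewrite [LHS]big_mkcondr [RHS]big_mkcondr /=.
      by apply: eq_bigr => k /nkp ->.
    (* On the old top level the bound for [j1] carries over; on a new level [c * lp] equals
       [#|B| * l j2], which is at least the whole sum over [B]. *)
    rewrite /sp /lp; case: ifP => [t|nt].
      apply: le_trans (gap _ j1B) _; rewrite ler_pM2l //.
      by move: lpL; rewrite /lp t.
    rewrite mulrA mulrCA divff ?gt_eqF // mulr1.
    apply: (@le_trans _ _ (\sum_(k in B) l k)).
      rewrite big_mkcondr /=; apply: ler_sum => k kB.
      by case: ifP => // _; rewrite ltW ?lgt0.
    rewrite mulr_natl -sumr_const; exact: ler_sum.
  have jB := inB _ jA jp.
  have -> : (sp < s j) = false by apply/negbTE; rewrite -leNgt (le_trans _ sps) ?s1.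
  rewrite add0r; apply: le_trans (gap _ jB).
  have nkp k : k \in B -> (k == p) = false by rewrite !inE => /andP[/negbTE].
  rewrite [leLHS]big_mkcondr [leRHS]big_mkcondr /=.
  by apply: ler_sum => k /nkp ->.
- move=> i j iA jA; rewrite AB /=.
  case: (eqVneq i p) => [_|ip]; case: (eqVneq j p) => [_|jp].
  + by rewrite ler_peMl ?(le_trans fB1) // ltW.
  + have jB := inB _ jA jp.
    apply: le_trans lpU _; rewrite fB -[leRHS]mulrA ler_pM2l ?divr_gt0 //.
    exact: ratio.
  + have iB := inB _ iA ip.
    apply: le_trans (ratio _ _ iB j1B) _.
    apply: (@le_trans _ _ (#|B|.-1`!%:R / c ^+ #|B|.-1 * lp)).
      by rewrite ler_pM2l // (lt_le_trans ltr01).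
    by rewrite ler_pM2r.
  + have [iB jB] := (inB _ iA ip, inB _ jA jp).
    apply: le_trans (ratio _ _ iB jB) _; by rewrite ler_pM2r ?lgt0.
Qed.

(** The choice of [c] gives [b * U * c = e * L]: the terms of [y] below a level, even magnified by
    [b], weigh less than one nonzero term on that level. Hence near-optimality for [l] gives control
    level by level. *)
Lemma approximation_transfer (X : Type) (Y : X -> J -> R) (l s : J -> R)
    (b e c L U : R) (x : X) :
  0 < L -> 0 < U -> 0 < e < 1 -> 1 <= b -> c = e * L / (b * U) ->
  (forall y i, Y y i = 0 \/ L <= Y y i <= U) ->
  (forall i, 0 < l i) -> (forall i, 0 <= s i) ->
  (forall j, \sum_(k | s k < s j) l k <= c * l j) ->
  (forall y, \sum_i l i * Y x i <= b * \sum_i l i * Y y i) ->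
  forall y, \sum_i s i * l i * Y x i <= (b + e) * \sum_i s i * l i * Y y i.
Proof.
move=> L0 U0 /andP[e0 e1] b1 cE YB l0 s0 gap opt y.
have b0 : 0 < b := lt_le_trans ltr01 b1.
have Y0 z i : 0 <= Y z i.
  by case: (YB z i) => [->|/andP[/(le_trans (ltW L0))]].
have YU z i : Y z i <= U by case: (YB z i) => [->|/andP[]//]; exact: ltW.
have lY0 z i : 0 <= l i * Y z i by rewrite mulr_ge0 // ltW.
have bUc : b * U * c = e * L by rewrite cE mulrC divfK // mulf_neq0 // gt_eqF.
have sY0 z i : 0 <= s i * l i * Y z i by rewrite -mulrA mulr_ge0.
(* If all [Y y i] vanish, near-optimality for [l] forces all [Y x i] to vanish, since every [l i] is
   positive. *)
have [/existsP[i0 i0P]|] := boolP [exists i, Y y i != 0]; last first.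
  move=> /existsPn yz.
  have yzero i : Y y i = 0 by apply/eqP; rewrite -[_ == _]negbK yz.
  have /psumr_eq0P -/(_ (fun i _ => lY0 x i)) xz : \sum_i l i * Y x i = 0.
    apply/eqP; rewrite eq_le sumr_ge0 // andbT.
    by apply: le_trans (opt y) _; rewrite big1 ?mulr0 // => i _; rewrite yzero mulr0.
  rewrite big1 ?mulr_ge0 ?sumr_ge0 ?addr_ge0 ?ltW // => i _.
  by rewrite -mulrA xz // mulr0.
(* The highest level that y sees. *)
pose m := [arg max_(i > i0 | Y y i != 0) s i]%O.
have [ym mmax] : Y y m != 0 /\ forall i, Y y i != 0 -> s i <= s m.
  by rewrite /m; case: arg_maxP.
have yz i : s m < s i -> Y y i = 0.
  by move=> lt; apply/eqP; apply: contraTT lt => /mmax; rewrite -leNgt.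
have ymL : L <= Y y m by case: (YB y m) ym => [->|/andP[]//]; rewrite eqxx.
have lowsum j (Q : pred J) : (forall k, Q k -> s k < s j) ->
    b * (\sum_(k | Q k) l k * Y y k) <= e * L * l j.
  move=> Qlt; rewrite -bUc -!mulrA ler_pM2l //.
  apply: (@le_trans _ _ (U * \sum_(k | s k < s j) l k)); last by rewrite ler_pM2l.
  rewrite mulr_sumr big_mkcond [leRHS]big_mkcond; apply: ler_sum => k _.
  case: ifP => [/Qlt ->|_]; first by rewrite mulrC ler_pM2r.
  by case: ifP => // _; rewrite mulr_ge0 // ltW.
(* A nonzero [Y x j] above the level of [m] would cost at least [l j * L], while [y] lives on lower
   levels and allows at most [e * L * l j], with [e < 1]. *)
have xz j : s m < s j -> Y x j = 0.
  move=> lt; case: (YB x j) => [//|/andP[Lx _]]; exfalso.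
  have : l j * L <= e * L * l j.
    apply: (@le_trans _ _ (\sum_i l i * Y x i)).
      rewrite (bigD1 j) //= -[leLHS]addr0 lerD ?sumr_ge0 //.
      by rewrite ler_pM2l.
    apply: le_trans (opt y) _.
    rewrite (bigID (fun k => s k < s j)) /= [X in _ + X]big1 ?addr0 ?lowsum //.
    by move=> k; rewrite -leNgt => jk; rewrite yz ?mulr0 // (lt_le_trans lt).
  by rewrite mulrAC ler_pM2r // leNgt gtr_pMl ?e1.
(* Since [x] vanishes above the level of [m], each [s i] in its sum may be replaced by [s m]. *)
apply: (@le_trans _ _ (s m * (b * \sum_i l i * Y y i))).
  apply: (@le_trans _ _ (s m * \sum_i l i * Y x i)).
    rewrite mulr_sumr; apply: ler_sum => i _; rewrite -mulrA.
    have [sim|/xz ->] := leP (s i) (s m); last by rewrite !mulr0.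
    exact: ler_wpM2r.
  exact: ler_wpM2l.
(* The terms of [y] on the level of [m] are matched with factor [b]; the terms below are paid for by
   [e] times the single term of [m]. *)
rewrite (bigID (fun k => s k < s m)) /= mulrDr mulrDr addrC [leRHS]mulrDl.
apply: lerD.
  rewrite mulrCA ler_pM2l // mulr_sumr big_mkcond; apply: ler_sum => i _.
  case: ifP => //; rewrite -leNgt le_eqVlt => /predU1P[<-|/yz ->].
    by rewrite mulrA.
  by rewrite !mulr0.
apply: (@le_trans _ _ (s m * (e * L * l m))).
  by apply: ler_wpM2l => //; apply: lowsum.
rewrite -!mulrA mulrCA ler_pM2l // (bigD1 m) //= -[leLHS]addr0 lerD ?sumr_ge0 //.
by rewrite -mulrA [L * _]mulrC ler_wpM2l // ler_pM2l.
Qed.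

End Compactification.

(** * The grid is fine enough *)

Section Logarithm.
Variables (R : realType) (r : R).
Hypothesis r1 : 1 < r.
Let r0 : 0 < r := lt_trans ltr01 r1.

Lemma le_logb (x y : R) : 0 < x -> x <= y -> logb r x <= logb r y.
Proof.
move=> x0 xy; rewrite /logb ler_pM2r ?invr_gt0 ?ln_gt0 //.
by rewrite ler_ln // posrE (lt_le_trans x0).
Qed.

Lemma logbV (x : R) : 0 < x -> logb r x^-1 = - logb r x.
Proof. by move=> x0; rewrite /logb lnV ?posrE // mulNr. Qed.

Lemma logb_le_int (x : R) (i : int) : 0 < x -> (logb r x <= i%:~R) = (x <= r ^ i).
Proof.
move=> x0; rewrite /logb ler_pdivrMr ?ln_gt0 //.
have -> : i%:~R * ln r = ln (r ^ i).
  case: i => n; first by rewrite lnXn // mulr_natl.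
  by rewrite NegzE -exprnN lnV ?posrE ?exprn_gt0 // lnXn // mulNr mulr_natl.
by rewrite ler_ln // posrE exprz_gt0.
Qed.

Lemma ceil_logb_le (x : R) (i : int) : 0 < x -> (Num.ceil (logb r x) <= i) = (x <= r ^ i).
Proof. by move=> x0; rewrite ceil_le_int logb_le_int. Qed.

End Logarithm.

(** * Approximation guarantee on the grid *)

Section GridApproximation.
Variables (R : realType) (K : nat) (P : problem R K).
Variables (lmin : data -> 'rV[R]_K) (LB UB : data -> rat).
Variables (eps : rat) (alpha : R) (ALG : program) (I : data).
Hypotheses (eps0 : 0 < eps) (eps1 : eps < 1) (alpha1 : 1 <= alpha).

Let r : R := 1 + ratr eps / 2.
Let e0 : 0 < ratr eps / 2 :> R. Proof. by rewrite divr_gt0 // ltr0q. Qed.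
Let e1 : ratr eps / 2 < 1 :> R.
Proof. by have : ratr eps < 1 :> R; [rewrite -(rmorph1 (@ratr R)) ltr_rat | lra]. Qed.
Let r1 : 1 < r. Proof. by rewrite ltrDl. Qed.

Lemma grid_beta_ge1 : 1 <= grid_beta eps alpha.
Proof. by rewrite mulr_ege1 // ltW. Qed.

Lemma grid_c_itv : 0 < LB I <= UB I -> 0 < grid_c LB UB eps alpha I <= 1.
Proof.
move=> /andP[L0 LU]; have := grid_beta_ge1; rewrite /grid_c => b1.
have b0 : 0 < grid_beta eps alpha := lt_le_trans ltr01 b1.
have L0' : 0 < ratr (LB I) :> R by rewrite ltr0q.
have LU' : ratr (LB I) <= ratr (UB I) :> R by rewrite ler_rat.
have U0 := lt_le_trans L0' LU'.
have d0 : 0 < grid_beta eps alpha * ratr (UB I) by rewrite mulr_gt0.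
apply/andP; split; first by rewrite divr_gt0 // mulr_gt0.
rewrite ler_pdivrMr // mul1r.
by apply: ler_pM => //; rewrite ltW // (lt_le_trans e1).
Qed.

Lemma objective_shift x (l m : 'rV[R]_K) :
  objective P I x l = objective P I x m + \sum_k (l 0 k - m 0 k) * bcoef P I k x.
Proof.
rewrite /objective -addrA -big_split /=; congr (_ + _).
by apply: eq_bigr => k _; rewrite -mulrDl addrC subrK.
Qed.

(** The output is described by runs of [ALG]; determinism identifies such a run with the one whose
    result the guarantee controls. *)
Lemma grid_output_feasible :
  params P I = [set l | forall k, lmin I 0 k <= l 0 k]%classic ->
  instance P I -> nonparam_alg P alpha ALG ->
  (grid_output lmin LB UB eps alpha ALG I `<=` feasible P I)%classic.
Proof.
move=> paramsE II algP x [i [_ [q [t [qE rx]]]]].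
have [|x' [t' [rx' /(_ I q erefl)[xf _]]]] := algP (Pair I (dvec q)).
  exists I, q; split=> //; rewrite paramsE /= => k.
  by rewrite qE mxE lerDl exprz_ge0 // ltW // (lt_trans ltr01).
by have [<- _] := run_det rx' rx.
Qed.

(** The hypothesis on [q0] makes the grid points rational, so that [ALG] can be called there, while
    [l] is real. Rounding and [ALG] together cost [grid_beta], the transfer from the rescaled
    weights adds [eps / 2], and [alpha >= 1] absorbs this into [(1 + eps) * alpha]. *)
Lemma grid_output_approx (q0 : 'rV[rat]_K) (l : 'rV[R]_K) :
  map_mx ratr q0 = lmin I ->
  params P I = [set l | forall k, lmin I 0 k <= l 0 k]%classic ->
  0 < LB I <= UB I ->
  (forall x, feasible P I x ->
     zero_or_between (LB I) (UB I) (objective P I x (lmin I)) /\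
     forall k, zero_or_between (LB I) (UB I) (bcoef P I k x)) ->
  instance P I -> nonparam_alg P alpha ALG -> params P I l ->
  exists2 x, grid_output lmin LB UB eps alpha ALG I x &
    forall x', feasible P I x' ->
      objective P I x l <= (1 + ratr eps) * alpha * objective P I x' l.
Proof.
move=> q0E paramsE LU vals II algP lP.
have LI0 : 0 < ratr (LB I) :> R by case/andP: LU; rewrite ltr0q.
have UI0 : 0 < ratr (UB I) :> R.
  by case/andP: LU => L0 /(lt_le_trans L0); rewrite ltr0q.
have r0 : 0 < r := lt_trans ltr01 r1.
pose c := grid_c LB UB eps alpha I.
have /andP[c0 c1] : 0 < c <= 1 := grid_c_itv LU.
pose T : R := K.+1`!%:R / c ^+ K.
have T0 : 0 < T by rewrite divr_gt0 ?exprn_gt0 // ltr0n fact_gt0.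
(* Index 0 stands for the objective at [lmin] with weight 1, the other indices for the [b_k]
   weighted by the shifted parameters. *)
pose w (j : 'I_K.+1) : R := oapp (fun k => l 0 k - lmin I 0 k) 1 (unlift ord0 j).
have w0 j : 0 <= w j.
  rewrite /w; case: unliftP => [k _|_] //=.
  by rewrite subr_ge0; move: lP; rewrite paramsE.
have [|g [s [gP gap ratio]]] := @separated_rescaling R _ c w [set: 'I_K.+1] c0 c1 w0.
  by apply/finset.set0Pn; exists ord0; rewrite inE.
have g0 j : 0 < g j by case: (gP j (finset.in_setT _)).
have s0 j : 0 <= s j by case: (gP j (finset.in_setT _)).
have wE j : w j = s j * g j by case: (gP j (finset.in_setT _)).
have {}gap j : \sum_(k | s k < s j) g k <= c * g j.
  by have := gap j (finset.in_setT _); under eq_bigl do rewrite inE /=.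
(* The rescaling yields the ratio [K! / c ^ K]; it is relaxed to the constant in the grid bounds. *)
have {ratio} ratio i j : g i <= T * g j.
  apply: le_trans (ratio i j (finset.in_setT _) (finset.in_setT _)) _.
  rewrite ler_pM2r // cardsT card_ord /= ler_pM2r ?invr_gt0 ?exprn_gt0 //.
  by rewrite ler_nat leq_fact.
pose h k := g (lift ord0 k) / g ord0.
have h0 k : 0 < h k by rewrite divr_gt0.
(* Rounding up: [i k] is the least exponent with [h k <= r ^ i k], so the overshoot is at most a
   factor [r]. *)
pose i k := Num.ceil (logb r (h k)).
have hi k : h k <= r ^ i k by rewrite -ceil_logb_le.
have ih k : r ^ i k <= r * h k.
  have : ~~ (h k <= r ^ (i k - 1)) by rewrite -ceil_logb_le // -ltNge ltrBlDr ltrDl.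
  rewrite -ltNge => /ltW; rewrite expfzDr ?gt_eqF // ler_pdivrMr ?expr1z //.
  by rewrite mulrC.
(* The ratio bound, read in both directions, puts [h k] between [T^-1] and [T], hence the exponents
   between the grid bounds. *)
have ilb k : grid_lb K LB UB eps alpha I <= i k.
  rewrite -(ler_int R); apply: le_trans (floor_le _) _.
  apply: le_trans (ceil_ge _); apply: (le_logb r1); rewrite ?divr_gt0 ?exprn_gt0 //.
    by rewrite ltr0n fact_gt0.
  rewrite -[leLHS]invrK invf_div -/c -/T -[leRHS]invrK lef_pV2 ?posrE ?invr_gt0 //.
  by rewrite invf_div ler_pdivrMr.
have iub k : i k <= grid_ub K LB UB eps alpha I.
  apply: le_ceil; apply: (le_logb r1) => //.
  by rewrite -/c -/T ler_pdivrMr.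
pose q : 'rV[rat]_K := \row_k (q0 0 k + (1 + eps / 2) ^ i k).
have qE : map_mx ratr q = grid_point lmin eps I i.
  apply/rowP => k; rewrite !mxE -q0E !mxE rmorphD /= rmorphXz ?rmorphD ?rmorph1 /=.
    by rewrite fmorph_div /= rmorph_nat.
  by rewrite unitfE gt_eqF // addr_gt0 // divr_gt0.
have [|x [t [rx /(_ I q erefl)[xf xopt]]]] := algP (Pair I (dvec q)).
  exists I, q; split=> //; rewrite paramsE /= => k.
  by rewrite qE mxE lerDl exprz_ge0 // ltW.
exists x; first by exists i; split=> [k|]; [rewrite ilb iub | exists q, t].
(* The transfer argument ranges over all points of a type, so the feasible solutions are packed into
   one. *)
pose Z := {x | feasible P I x}.
pose Y (x : Z) (j : 'I_K.+1) : R :=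
  oapp (fun k => bcoef P I k (sval x)) (objective P I (sval x) (lmin I)) (unlift ord0 j).
have YP z j : Y z j = 0 \/ ratr (LB I) <= Y z j <= ratr (UB I).
  by have [ob bb] := vals _ (svalP z); rewrite /Y; case: unliftP => [k _|_] //=; apply: bb.
have Y0 z j : 0 <= Y z j.
  by case: (YP z j) => [->|/andP[/(le_trans (ltW LI0))]].
have sumY (f : 'I_K.+1 -> R) z : \sum_j f j * Y z j =
    f ord0 * objective P I (sval z) (lmin I) +
    \sum_k f (lift ord0 k) * bcoef P I k (sval z).
  rewrite big_ord_recl {1}/Y unlift_none /=; congr (_ + _).
  by apply: eq_bigr => k _; rewrite /Y liftK.
have objE z : objective P I (sval z) l = \sum_j s j * g j * Y z j.
  under eq_bigr do rewrite -wE.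
  rewrite sumY {1}/w unlift_none mul1r (objective_shift _ _ (lmin I)); congr (_ + _).
  by apply: eq_bigr => k _; rewrite /w liftK.
pose b := grid_beta eps alpha.
(* Three comparisons: raise [h k] to [r ^ i k], apply the guarantee of [ALG] at the grid point,
   lower [r ^ i k] to [r * h k]. *)
have main (z : Z) : \sum_j g j * Y (exist _ x xf) j <= b * \sum_j g j * Y z j.
  have gE (u : Z) : \sum_j g j * Y u j = g ord0 * (objective P I (sval u) (lmin I) +
      \sum_k h k * bcoef P I k (sval u)).
    rewrite sumY [RHS]mulrDr mulr_sumr; congr (_ + _); apply: eq_bigr => k _.
    by rewrite /h mulrA mulrCA divff ?gt_eqF // mulr1.
  have gpE (u : Z) : objective P I (sval u) (map_mx ratr q) =
      objective P I (sval u) (lmin I) + \sum_k r ^ i k * bcoef P I k (sval u).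
    rewrite (objective_shift _ _ (lmin I)) qE; congr (_ + _).
    by apply: eq_bigr => k _; rewrite mxE addrC addKr.
  have bY (u : Z) k : 0 <= bcoef P I k (sval u).
    by have := Y0 u (lift ord0 k); rewrite /Y liftK.
  have oY (u : Z) : 0 <= objective P I (sval u) (lmin I).
    by have := Y0 u ord0; rewrite /Y unlift_none.
  rewrite !gE mulrCA ler_pM2l //.
  apply: (@le_trans _ _ (objective P I x (map_mx ratr q))).
    rewrite (gpE (exist _ x xf)) lerD2l; apply: ler_sum => k _.
    exact/ler_wpM2r/hi/bY.
  apply: le_trans (xopt _ (svalP z)) _.
  have -> : b = alpha * r by exact: mulrC.
  rewrite -[leRHS]mulrA ler_pM2l ?(lt_le_trans ltr01) //.
  rewrite gpE [leRHS]mulrDr; apply: lerD; first by rewrite ler_peMl ?oY // ltW.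
  rewrite mulr_sumr; apply: ler_sum => k _; rewrite mulrA.
  exact/ler_wpM2r/ih/bY.
move=> x' x'f.
rewrite (objE (exist _ x xf)) (objE (exist _ x' x'f)).
have e01 : 0 < (ratr eps / 2 : R) < 1 by rewrite e0 e1.
apply: le_trans (@approximation_transfer R _ _ Y g s b _ c (ratr (LB I)) (ratr (UB I)) _
  LI0 UI0 e01 grid_beta_ge1 erefl YP g0 s0 gap main (exist _ x' x'f)) _.
apply: ler_wpM2r; first by rewrite sumr_ge0 // => j _; rewrite !mulr_ge0 // ltW.
rewrite /b /grid_beta; have := e0; have := alpha1; nra.
Qed.

End GridApproximation.

(** * Polynomially bounded families of runs *)

(* [ssrnat] also has a constructor [Num]; below, [Num] is that of [data]. *)
Import Defs.

Lemma leq_wexp2r (m n k : nat) : (m <= n)%N -> (m ^ k <= n ^ k)%N.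
Proof. by move=> mn; case: k => // k; rewrite leq_exp2r. Qed.

Section PolyBounded.
Variable J : Type.
Implicit Types (D : J -> Prop) (N f g : J -> nat).

(* The base is at least 2, so sums, products and compositions of such bounds
   are again bounded by a single power. *)
Definition poly_bounded D N f := exists k, forall j, D j -> (f j <= (N j).+2 ^ k)%N.

Variables (D : J -> Prop) (N : J -> nat).

Lemma pb_le f g : (forall j, D j -> (f j <= g j)%N) ->
  poly_bounded D N g -> poly_bounded D N f.
Proof. by move=> fg [k H]; exists k => j Dj; apply: leq_trans (fg j Dj) (H j Dj). Qed.

Lemma pb_size : poly_bounded D N N.
Proof. by exists 1%N => j _; rewrite expn1 leqW. Qed.

Lemma pb_const c : poly_bounded D N (fun=> c).
Proof.
exists c => j _; apply: leq_trans (_ : (2 ^ c <= _)%N); first exact/ltnW/ltn_expl.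
by rewrite leq_wexp2r.
Qed.

Lemma pb_mul f g : poly_bounded D N f -> poly_bounded D N g ->
  poly_bounded D N (fun j => f j * g j)%N.
Proof.
move=> [k Hf] [l Hg]; exists (k + l)%N => j Dj.
by rewrite expnD leq_mul ?Hf ?Hg.
Qed.

Lemma pb_add f g : poly_bounded D N f -> poly_bounded D N g ->
  poly_bounded D N (fun j => f j + g j)%N.
Proof.
move=> [k Hf] [l Hg]; exists (k + l).+1 => j Dj.
have := Hf j Dj; have := Hg j Dj; rewrite expnS expnD.
have : (0 < (N j).+2 ^ k)%N by rewrite expn_gt0.
have : (0 < (N j).+2 ^ l)%N by rewrite expn_gt0.
set a := ((N j).+2 ^ k)%N; set b := ((N j).+2 ^ l)%N => *; nia.
Qed.

Lemma pb_succ f : poly_bounded D N f -> poly_bounded D N (fun j => (f j).+1).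
Proof. by move/(pb_add (pb_const 1)). Qed.

Lemma pb_exp f k : poly_bounded D N f -> poly_bounded D N (fun j => f j ^ k)%N.
Proof.
by move=> [l Hf]; exists (l * k)%N => j Dj; rewrite expnM leq_wexp2r ?Hf.
Qed.

End PolyBounded.

(** * Encoding lengths of rationals and lists *)

Lemma trunc_log_lt (n m : nat) : (0 < m)%N -> (n < 2 ^ m)%N -> (trunc_log 2 n < m)%N.
Proof.
case: n => [|n] m0 nm; first by rewrite trunc_log0.
have /andP[le _] := @trunc_log_bounds 2 n.+1 isT isT.
by rewrite -(@ltn_exp2l 2) // (leq_ltn_trans le).
Qed.

Lemma nbits_ltn (z : int) : (`|z| < 2 ^ nbits z)%N.
Proof. exact: trunc_log_ltn. Qed.

Lemma nbits_le (a b : int) : (`|a| <= `|b|)%N -> (nbits a <= nbits b)%N.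
Proof. by move=> ab; rewrite ltnS leq_trunc_log. Qed.

Lemma nbits_mul (a b : int) : (nbits (a * b) <= nbits a + nbits b)%N.
Proof.
apply: trunc_log_lt; rewrite ?addn_gt0 // abszM expnD.
by apply: ltn_mul; apply: nbits_ltn.
Qed.

(** Both powers of two are at least 2, so their sum does not exceed their product. *)
Lemma nbits_add (a b : int) : (nbits (a + b) <= nbits a + nbits b)%N.
Proof.
apply: trunc_log_lt; rewrite ?addn_gt0 //.
have := nbits_ltn a; have := nbits_ltn b; rewrite expnD.
have : (2 <= 2 ^ nbits a)%N by rewrite -{1}(expn1 2) leq_exp2l.
have : (2 <= 2 ^ nbits b)%N by rewrite -{1}(expn1 2) leq_exp2l.
set x := (2 ^ nbits a)%N; set y := (2 ^ nbits b)%N; nia.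
Qed.

(** Reduction to lowest terms divides both entries by a common factor and so never lengthens
    them. *)
Lemma nbits_frac (n d : int) : d != 0 ->
  (nbits (numq (n%:Q / d%:Q)) <= nbits n)%N /\ (nbits (denq (n%:Q / d%:Q)) <= nbits d)%N.
Proof.
case: divqP => [_|k x k0 _]; first by rewrite eqxx.
have k1 : (0 < `|k|)%N by rewrite absz_gt0.
by split; apply: nbits_le; rewrite abszM leq_pmull.
Qed.

Lemma dsize_num_mul (a b : rat) :
  (dsize (Num (a * b)%R) <= dsize (Num a) + dsize (Num b))%N.
Proof.
have E : a * b = (numq a * numq b)%:Q / (denq a * denq b)%:Q.
  by rewrite !intrM invfM mulrACA !divq_num_den.
have [] := @nbits_frac (numq a * numq b) (denq a * denq b).
  by rewrite mulf_neq0 ?denq_neq0.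
rewrite -E /=; have := nbits_mul (numq a) (numq b); have := nbits_mul (denq a) (denq b).
lia.
Qed.

(** Cross-multiplication uses each denominator twice, whence the factor 2. *)
Lemma dsize_num_add (a b : rat) :
  (dsize (Num (a + b)%R) <= 2 * (dsize (Num a) + dsize (Num b)))%N.
Proof.
have E : a + b = (numq a * denq b + numq b * denq a)%:Q / (denq a * denq b)%:Q.
  rewrite -{1}[a]divq_num_den -{1}[b]divq_num_den addf_div ?intr_eq0 ?denq_neq0 //.
  by rewrite -!intrM -intrD.
have [] := @nbits_frac (numq a * denq b + numq b * denq a) (denq a * denq b).
  by rewrite mulf_neq0 ?denq_neq0.
rewrite -E /=.
have := nbits_add (numq a * denq b) (numq b * denq a).
have := nbits_mul (numq a) (denq b); have := nbits_mul (numq b) (denq a).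
have := nbits_mul (denq a) (denq b).
move: (nbits (numq a * denq b + _)) (nbits (_ * _)) (nbits (_ * _)) (nbits (_ * _)).
by lia.
Qed.

Lemma dsize_num_inv (a : rat) : (dsize (Num a^-1%R) <= dsize (Num a))%N.
Proof.
have [->|a0] := eqVneq a 0; first by rewrite invr0.
have E : a^-1 = (denq a)%:Q / (numq a)%:Q by rewrite -{1}[a]divq_num_den invf_div.
have [] := @nbits_frac (denq a) (numq a); first by rewrite numq_eq0.
by rewrite -E /=; lia.
Qed.

(** Lengths add under multiplication, so those of powers grow linearly; the summand 3 is the length
    of [Num 1]. *)
Lemma dsize_num_exp (a : rat) n : (dsize (Num (a ^+ n)%R) <= n * dsize (Num a) + 3)%N.
Proof.
elim: n => [|n IH]; first by rewrite expr0 mul0n add0n.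
by rewrite exprS mulSn -addnA; apply: leq_trans (dsize_num_mul _ _) _; rewrite leq_add2l.
Qed.

Lemma rat_le_dsize (a : rat) : a <= (2 ^ dsize (Num a))%:R.
Proof.
apply: (@le_trans _ _ (`|numq a|%N%:R)).
  rewrite -{1}[a]divq_num_den ler_pdivrMr ?ltr0z ?denq_gt0 //.
  rewrite [`|numq a|%N%:R]pmulrn -intrM ler_int.
  by have := denq_gt0 a; nia.
rewrite ler_nat; apply: leq_trans (ltnW (nbits_ltn _)) _.
by rewrite leq_exp2l //= -addnS leq_addr.
Qed.

Lemma dsize_dlist (s : seq data) : dsize (dlist s) = (\sum_(x <- s) (dsize x).+1 + 3)%N.
Proof. by elim: s => [|x s IH]; rewrite ?big_nil // big_cons /= IH addnA addSn. Qed.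

Lemma size_le_dsize (s : seq data) : (size s <= dsize (dlist s))%N.
Proof. by elim: s => //= x s IH; rewrite ltnS (leq_trans IH) ?leq_addl. Qed.

(** * Programs with uniform polynomial running time *)

Section Computes.
Variable J : Type.
Implicit Types (D : J -> Prop) (N : J -> nat) (f g : J -> data) (A B : J -> program).

Definition small D N f := poly_bounded D N (fun j => dsize (f j)).

(* The bound is uniform over the index type J.  Indexing the body of a loop by
   pairs (index, round) makes its running time independent of the round. *)
Definition computes D N A f g := exists T, poly_bounded D N T /\
  forall j, D j -> exists2 t, run (A j) (f j) (g j) t & (t <= T j)%N.

Variables (D : J -> Prop) (N : J -> nat).

Lemma small_const c : small D N (fun=> c).
Proof. exact: pb_const. Qed.

Lemma small_pair f g : small D N f -> small D N g -> small D N (fun j => Pair (f j) (g j)).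
Proof. by move=> *; apply/pb_succ/pb_add. Qed.

Lemma small_fst f g : small D N (fun j => Pair (f j) (g j)) -> small D N f.
Proof. by apply: pb_le => j _ /=; rewrite leqW ?leq_addr. Qed.

Lemma small_snd f g : small D N (fun j => Pair (f j) (g j)) -> small D N g.
Proof. by apply: pb_le => j _ /=; rewrite leqW ?leq_addl. Qed.

Lemma small_bool (b : J -> bool) : small D N (fun j => Num (b j)%:R).
Proof. by apply: pb_le (pb_const _ _ 3) => j _; case: (b j). Qed.

Lemma small_mul (a b : J -> rat) : small D N (fun j => Num (a j)) ->
  small D N (fun j => Num (b j)) -> small D N (fun j => Num (a j * b j)).
Proof. by move=> ha hb; apply: pb_le (pb_add ha hb) => j _; apply: dsize_num_mul. Qed.

Lemma small_add (a b : J -> rat) : small D N (fun j => Num (a j)) ->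
  small D N (fun j => Num (b j)) -> small D N (fun j => Num (a j + b j)).
Proof.
move=> ha hb; apply: pb_le (pb_mul (pb_const _ _ 2) (pb_add ha hb)) => j _.
exact: dsize_num_add.
Qed.

Lemma small_inv (a : J -> rat) : small D N (fun j => Num (a j)) ->
  small D N (fun j => Num (a j)^-1).
Proof. by apply: pb_le => j _; apply: dsize_num_inv. Qed.

Lemma small_exp (a : J -> rat) (n : J -> nat) : small D N (fun j => Num (a j)) ->
  poly_bounded D N n -> small D N (fun j => Num (a j ^+ n j)).
Proof.
move=> ha hn; apply: pb_le (pb_add (pb_mul hn ha) (pb_const _ _ 3)) => j _.
exact: dsize_num_exp.
Qed.

Lemma computes_small A f g : computes D N A f g -> small D N f /\ small D N g.
Proof.
by move=> [T [pT H]]; split; apply: pb_le pT => j /H[t /run_size[? ?]]; apply: leq_trans.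
Qed.

Lemma computes_prim (o : J -> prim) f g :
  (forall j, D j -> prim_step (o j) (f j) = Some (g j)) ->
  small D N f -> small D N g -> computes D N (fun j => Prim (o j)) f g.
Proof.
move=> E sf sg; exists (fun j => dsize (f j) + dsize (g j))%N; split; first exact: pb_add.
by move=> j Dj; exists (dsize (f j) + dsize (g j))%N => //; apply/RunPrim/E.
Qed.

Lemma computes_seq A B f g h : computes D N A f g -> computes D N B g h ->
  computes D N (fun j => Seq (A j) (B j)) f h.
Proof.
move=> [T [pT HA]] [U [pU HB]]; exists (fun j => (T j + U j).+1); split.
  exact/pb_succ/pb_add.
move=> j Dj; have [t rA tT] := HA j Dj; have [u rB uU] := HB j Dj.
by exists (t + u).+1; [apply: RunSeq rA rB | rewrite ltnS leq_add].
Qed.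

Lemma computes_fork A B f g h : computes D N A f g -> computes D N B f h ->
  computes D N (fun j => Fork (A j) (B j)) f (fun j => Pair (g j) (h j)).
Proof.
move=> [T [pT HA]] [U [pU HB]]; exists (fun j => (T j + U j).+1); split.
  exact/pb_succ/pb_add.
move=> j Dj; have [t rA tT] := HA j Dj; have [u rB uU] := HB j Dj.
by exists (t + u).+1; [apply: RunFork rA rB | rewrite ltnS leq_add].
Qed.

Lemma computes_if C A B f g (b : J -> bool) :
  computes D N C f (fun j => Num (b j)%:R) ->
  computes (fun j => D j /\ b j) N A f g ->
  computes (fun j => D j /\ ~~ b j) N B f g ->
  computes D N (fun j => If (C j) (A j) (B j)) f g.
Proof.
move=> [T [pT HC]] [U [[k pU] HA]] [V [[l pV] HB]].
(* The time bounds of the branches are polynomial only on their own parts of the domain, so the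
   dominating powers stand in for them. *)
exists (fun j => (T j + ((N j).+2 ^ k + (N j).+2 ^ l)).+1); split.
  by apply/pb_succ/pb_add => //; apply: pb_add; [exists k | exists l].
move=> j Dj; have [t rC tT] := HC j Dj.
case: (boolP (b j)) rC => bj rC.
  have [u rA uU] := HA j (conj Dj bj); exists (t + u).+1; first exact: RunIfTrue rC _ rA.
  by rewrite ltnS leq_add // (leq_trans uU) // (leq_trans (pU _ (conj Dj bj))) ?leq_addr.
have [u rB uU] := HB j (conj Dj bj); exists (t + u).+1; first exact: RunIfFalse rC rB.
by rewrite ltnS leq_add // (leq_trans uU) // (leq_trans (pV _ (conj Dj bj))) ?leq_addl.
Qed.

Lemma computes_ext A f f' g g' : (forall j, D j -> f j = f' j) ->
  (forall j, D j -> g j = g' j) -> computes D N A f g -> computes D N A f' g'.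
Proof.
move=> ff gg [T [pT H]]; exists T; split=> // j Dj.
by rewrite -ff // -gg //; apply: H.
Qed.

End Computes.

(** [S j i] is the state before round [i], and [n j] the number of rounds. A test and a round
    together have a time bound independent of [i]; the total is at most [n j + 1] times that bound,
    the extra 1 paying for the final test. *)
Lemma computes_while (J : Type) (D : J -> Prop) N C B (S : J -> nat -> data) (n : J -> nat) :
  poly_bounded D N n ->
  computes (fun p : J * nat => D p.1 /\ (p.2 <= n p.1)%N) (fun p => N p.1)
    (fun p => C p.1) (fun p => S p.1 p.2) (fun p => Num (p.2 < n p.1)%N%:R) ->
  computes (fun p : J * nat => D p.1 /\ (p.2 < n p.1)%N) (fun p => N p.1)
    (fun p => B p.1) (fun p => S p.1 p.2) (fun p => S p.1 p.2.+1) ->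
  computes D N (fun j => While (C j) (B j)) (S^~ 0%N) (fun j => S j (n j)).
Proof.
move=> pn [T [[k pT] HC]] [U [[l pU] HB]].
pose M j := ((N j).+2 ^ k + (N j).+2 ^ l).+1.
exists (fun j => (n j).+1 * M j)%N; split.
  apply: pb_mul; first exact: pb_succ.
  by apply/pb_succ/pb_add; [exists k | exists l].
move=> j Dj.
have step m : forall i, (m + i = n j)%N ->
    exists2 t, run (While (C j) (B j)) (S j i) (S j (n j)) t & (t <= m.+1 * M j)%N.
  elim: m => [|m IH] i mi.
    have Dji : D j /\ (i <= n j)%N by split=> //; lia.
    have [t rC tT] := HC (j, i) Dji; have /= tk := leq_trans tT (pT (j, i) Dji).
    move: rC; rewrite /= -mi add0n ltnn => rC.
    by exists t.+1; [apply: RunWhileStop rC | rewrite mul1n ltnS (leq_trans tk) ?leq_addr].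
  have Dji : D j /\ (i <= n j)%N by split=> //; lia.
  have Dji' : D j /\ (i < n j)%N by split=> //; lia.
  have [t rC tT] := HC (j, i) Dji; have /= tk := leq_trans tT (pT (j, i) Dji).
  have [u rB uU] := HB (j, i) Dji'; have /= ul := leq_trans uU (pU (j, i) Dji').
  have [|v rW vM] := IH i.+1; first by lia.
  exists (t + u + v).+1; last by rewrite mulSn /M in vM *; lia.
  by apply: RunWhileStep rC _ rB rW; rewrite /= (proj2 Dji').
by have [|t rt tM] := step (n j) 0%N; [rewrite addn0 | exists t].
Qed.

(** Polynomial bounds compose; this moves bounds on the calls of a program to the indices of the
    loop that makes the calls. *)
Lemma pb_pull (J J' : Type) (D : J -> Prop) (D' : J' -> Prop) N N' (phi : J -> J') f :
  (forall j, D j -> D' (phi j)) -> poly_bounded D N (fun j => N' (phi j)) ->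
  poly_bounded D' N' f -> poly_bounded D N (fun j => f (phi j)).
Proof.
move=> DD pN [k pf].
apply: pb_le (pb_exp k (pb_succ (pb_succ pN))) => j Dj.
exact/pf/DD.
Qed.

Lemma computes_pull (J J' : Type) (D : J -> Prop) (D' : J' -> Prop) N N' (phi : J -> J') A f g :
  (forall j, D j -> D' (phi j)) -> poly_bounded D N (fun j => N' (phi j)) ->
  computes D' N' A f g ->
  computes D N (fun j => A (phi j)) (fun j => f (phi j)) (fun j => g (phi j)).
Proof.
move=> DD pN [T [pT H]]; exists (fun j => T (phi j)); split; first exact: pb_pull pT.
by move=> j Dj; apply/H/DD.
Qed.

Lemma small_lift (J J' : Type) (D : J -> Prop) (D' : J' -> Prop) N N' (phi : J' -> J) f :
  (forall p, D' p -> D (phi p)) -> (forall p, N (phi p) <= N' p)%N ->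
  small D N f -> small D' N' (fun p => f (phi p)).
Proof.
by move=> DD NN; apply: pb_pull DD _; apply: pb_le (pb_size _ N') => p _; apply: NN.
Qed.

(** * Loops over lists *)

Notation "A ;; B" := (Seq A B) (at level 51, right associativity).
Notation Fst := (Prim PFst).
Notation Snd := (Prim PSnd).
Notation Const c := (Prim (PConst c)).

Ltac solve_small := repeat first
  [ assumption | apply: small_pair | apply: small_const | apply: small_bool
  | apply: small_mul | apply: small_add | apply: small_inv ].

(** Evaluating [prim_step] determines every intermediate value of a loop-free program; only the
    smallness of these values is left to [solve_small]. *)
Ltac straight_line := repeat first
  [ eapply computes_seq | eapply computes_fork
  | eapply computes_prim; [by move=> ? _ /=; reflexivity | |] ].

Section Foreach.
Variables (X Y : eqType) (encX : X -> data) (encY : Y -> data).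

Definition encode_seq (Z : Type) (enc : Z -> data) (s : seq Z) := dlist (map enc s).

(** The state consists of the environment, the remaining input and the accumulated output. A list
    ends in a leaf, so [PIsNum] is the end test. Results are consed onto the accumulator, which is
    why [catrev] describes the outcome below. *)
Definition foreach (B : program) : program :=
  While (If (Snd ;; Fst ;; Prim PIsNum) (Const (Num 0)) (Const (Num 1)))
    (Fork Fst (Fork (Snd ;; Fst ;; Snd)
       (Fork Fst (Fork (Snd ;; Fst ;; Fst) (Snd ;; Snd)) ;; B))) ;;
  Snd ;; Snd.

Lemma dsize_encode_cat (a b : seq Y) :
  (dsize (encode_seq encY (a ++ b)) + 3 =
   dsize (encode_seq encY a) + dsize (encode_seq encY b))%N.
Proof. rewrite /encode_seq !dsize_dlist map_cat big_cat /=; lia. Qed.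

Lemma dsize_encode_catrev (a b : seq Y) :
  dsize (encode_seq encY (catrev a b)) = dsize (encode_seq encY (a ++ b)).
Proof.
rewrite /encode_seq !dsize_dlist; congr (_ + _)%N; rewrite !big_map.
by apply: perm_big; rewrite catrevE perm_cat2r perm_rev.
Qed.

Variables (J : Type) (D : J -> Prop) (N : J -> nat).
Variables (s : J -> seq X) (h : J -> X -> seq Y).

Lemma small_flatten :
  small (fun p : J * X => D p.1 /\ p.2 \in s p.1) (fun p => N p.1)
    (fun p => encode_seq encY (h p.1 p.2)) ->
  poly_bounded D N (fun j => size (s j)) ->
  small D N (fun j => encode_seq encY (flatten (map (h j) (s j)))).
Proof.
move=> [k hk] ps.
have pk : poly_bounded D N (fun j => (N j).+2 ^ k)%N by exists k.
apply: pb_le (pb_add (pb_mul ps pk) (pb_const _ _ 3)) => j Dj.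
rewrite /encode_seq map_flatten dsize_dlist big_flatten -!map_comp big_map leq_add2r.
have -> : (size (s j) * (N j).+2 ^ k = \sum_(x <- s j) (N j).+2 ^ k)%N.
  by rewrite big_const_seq count_predT iter_addn_0 mulnC.
rewrite big_seq [leqRHS]big_seq; apply: leq_sum => x xs.
by apply: leq_trans (hk (j, x) (conj Dj xs)); rewrite /encode_seq dsize_dlist leq_addr.
Qed.

(* The body must handle an arbitrary list u of earlier results, so its running
   time may depend on the size of u; that this size stays polynomial follows from
   the hypothesis on h. *)
Lemma computes_foreach (x0 : X) (B : J -> program) (env : J -> data) (t : J -> seq Y) :
  small D N env -> small D N (fun j => encode_seq encX (s j)) ->
  small D N (fun j => encode_seq encY (t j)) ->
  small (fun p : J * X => D p.1 /\ p.2 \in s p.1) (fun p => N p.1)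
    (fun p => encode_seq encY (h p.1 p.2)) ->
  computes (fun p : J * X * seq Y => D p.1.1 /\ p.1.2 \in s p.1.1)
    (fun p => N p.1.1 + dsize (encode_seq encY p.2))%N
    (fun p => B p.1.1)
    (fun p => Pair (env p.1.1) (Pair (encX p.1.2) (encode_seq encY p.2)))
    (fun p => encode_seq encY (catrev (h p.1.1 p.1.2) p.2)) ->
  computes D N (fun j => foreach (B j))
    (fun j => Pair (env j) (Pair (encode_seq encX (s j)) (encode_seq encY (t j))))
    (fun j => encode_seq encY (catrev (flatten (map (h j) (s j))) (t j))).
Proof.
move=> senv ss st sh HB.
have psz : poly_bounded D N (fun j => size (s j)).
  by apply: pb_le ss => j _; rewrite -(size_map encX); apply: size_le_dsize.
have sflat := small_flatten sh psz.
(* [acc j i] is the accumulated output after [i] rounds; being part of the final output, it is small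
   uniformly in [i]. *)
pose acc j i := catrev (flatten (map (h j) (take i (s j)))) (t j).
have acc_le j i : (dsize (encode_seq encY (acc j i)) <=
    dsize (encode_seq encY (flatten (map (h j) (s j)))) + dsize (encode_seq encY (t j)))%N.
  rewrite /acc dsize_encode_catrev.
  have := dsize_encode_cat (flatten (map (h j) (take i (s j)))) (t j).
  have := dsize_encode_cat (flatten (map (h j) (take i (s j))))
                           (flatten (map (h j) (drop i (s j)))).
  rewrite -flatten_cat -map_cat cat_take_drop; lia.
have acc0 j : acc j 0%N = t j by rewrite /acc take0.
have accn j : acc j (size (s j)) = catrev (flatten (map (h j) (s j))) (t j).
  by rewrite /acc take_size.
have accS j i : (i < size (s j))%N ->
    acc j i.+1 = catrev (h j (nth x0 (s j) i)) (acc j i).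
  move=> lt; rewrite /acc (take_nth x0) // -cats1 map_cat flatten_cat /= cats0.
  by rewrite !catrevE rev_cat -catA.
pose S j i := Pair (env j) (Pair (encode_seq encX (drop i (s j))) (encode_seq encY (acc j i))).
have lift_small f (Q : J * nat -> Prop) (QD : forall p, Q p -> D p.1) :
    small D N f -> small Q (fun p => N p.1) (fun p => f p.1) by exact: small_lift.
have small_drop (Q : J * nat -> Prop) (i : J * nat -> nat) : (forall p, Q p -> D p.1) ->
    small Q (fun p => N p.1) (fun p => encode_seq encX (drop (i p) (s p.1))).
  move=> QD; apply: pb_le (lift_small _ _ QD ss) => p _.
  rewrite /encode_seq !dsize_dlist leq_add2r -{2}(cat_take_drop (i p) (s p.1)).
  by rewrite map_cat big_cat leq_addl.
have small_acc (Q : J * nat -> Prop) : (forall p, Q p -> D p.1) ->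
    small Q (fun p => N p.1) (fun p => encode_seq encY (acc p.1 p.2)).
  move=> QD; apply: pb_le (fun p _ => acc_le p.1 p.2) _.
  exact: pb_add (lift_small _ _ QD sflat) (lift_small _ _ QD st).
have small_S (Q : J * nat -> Prop) : (forall p, Q p -> D p.1) ->
    small Q (fun p => N p.1) (fun p => S p.1 p.2).
  move=> QD; apply: small_pair; first exact: lift_small senv.
  by apply: small_pair; [apply: small_drop | apply: small_acc].
rewrite /foreach; apply: (computes_seq (g := fun j => S j (size (s j)))); last first.
  have -> : (fun j => S j (size (s j))) = fun j => Pair (env j) (Pair (encode_seq encX [::])
      (encode_seq encY (catrev (flatten (map (h j) (s j))) (t j)))).
    by apply/funext => j; rewrite /S accn drop_size.
  have sres : small D N (fun j => encode_seq encY (catrev (flatten (map (h j) (s j))) (t j))).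
    by apply: pb_le (pb_add sflat st) => j _; rewrite -accn.
  by straight_line; solve_small.
have -> : (fun j => Pair (env j) (Pair (encode_seq encX (s j)) (encode_seq encY (t j)))) =
    S^~ 0%N by apply/funext => j; rewrite /S drop0 acc0.
apply: (@computes_while _ _ _ _ _ S (fun j => size (s j))) => //.
- apply: (computes_if (b := fun p : J * nat => ~~ (p.2 < size (s p.1))%N)).
  + have QD p : D p.1 /\ (p.2 <= size (s p.1))%N -> D p.1 by case.
    have sS := small_S _ QD; have /small_snd sl := sS; have /small_fst sd := sl.
    apply: (computes_seq (g := fun p => Pair (encode_seq encX (drop p.2 (s p.1)))
      (encode_seq encY (acc p.1 p.2)))).
      exact: (computes_prim (o := fun=> PSnd)).
    apply: (computes_seq (g := fun p => encode_seq encX (drop p.2 (s p.1)))).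
      exact: (computes_prim (o := fun=> PFst)).
    (* The remaining list is encoded by a leaf exactly when all elements have been consumed. *)
    apply: (computes_prim (o := fun=> PIsNum)); [|by []|exact: small_bool] => -[j i] [_ /= le].
    case: ltnP => lt; last by rewrite drop_oversize.
    by case E: (drop i (s j)) (size_drop i (s j)) => //= /eqP; rewrite eq_sym subn_eq0 leqNgt lt.
  + apply: (computes_prim (o := fun=> PConst _)) => [p [_ /negPf ->]//||].
      by apply: small_S => p [[]].
    exact: small_bool.
  + apply: (computes_prim (o := fun=> PConst _)) => [p [_ /negbNE ->]//||].
      by apply: small_S => p [[]].
    exact: small_bool.
pose Q (p : J * nat) := D p.1 /\ (p.2 < size (s p.1))%N.
have QD p : Q p -> D p.1 by case.
have sS := small_S _ QD.
pose x (p : J * nat) := nth x0 (s p.1) p.2.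
apply: (@computes_ext _ _ _ _ (fun p => Pair (env p.1) (Pair (Pair (encX (x p))
    (encode_seq encX (drop p.2.+1 (s p.1)))) (encode_seq encY (acc p.1 p.2)))) _
    (fun p => Pair (env p.1) (Pair (encode_seq encX (drop p.2.+1 (s p.1)))
      (encode_seq encY (catrev (h p.1 (x p)) (acc p.1 p.2)))))).
- by move=> p [_ lt]; rewrite /S (drop_nth x0 lt).
- by move=> p [_ lt]; rewrite /S accS.
have HB' : computes Q (fun p => N p.1) (fun p => B p.1)
   (fun p => Pair (env p.1) (Pair (encX (x p)) (encode_seq encY (acc p.1 p.2))))
   (fun p => encode_seq encY (catrev (h p.1 (x p)) (acc p.1 p.2))).
  apply: (computes_pull (phi := fun p => (p.1, x p, acc p.1 p.2)) _ _ HB).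
    by move=> p [Dp lt]; split=> //; apply: mem_nth.
  by apply: pb_add (small_acc _ QD); apply: pb_size.
have [si _] := computes_small HB'; have /small_snd/small_fst sx := si.
have se := lift_small _ _ QD senv; have sa := small_acc _ QD.
have sd := small_drop Q (fun p => p.2.+1) QD.
do 2 (apply: computes_fork; first by straight_line; solve_small).
apply: (computes_seq _ HB'); by straight_line; solve_small.
Qed.
End Foreach.

(** * Enumeration of the grid *)

(** The exponents run from [-n] to [n], as the grid bounds are opposite; the newest power and its
    inverse come first because the loop conses them. *)
Fixpoint powers (r : rat) (n : nat) : seq rat :=
  if n is n'.+1 then [:: r ^+ n, (r ^+ n)^-1 & powers r n'] else [:: 1].

Lemma mem_powers (r : rat) n x :
  reflect (exists2 i : int, (`|i| <= n)%N & x = r ^ i) (x \in powers r n).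
Proof.
apply: (iffP idP).
  elim: n => [|n IH] /=; first by rewrite inE => /eqP ->; exists 0.
  rewrite !inE => /or3P[/eqP ->|/eqP ->|/IH[i le ->]].
  - by exists n.+1.
  - by exists (- n.+1%:Z) => //; rewrite -exprnN.
  - by exists i => //; apply: leqW.
move=> [i le ->]; elim: n le => [|n IH] /=; first by rewrite leqn0 absz_eq0 => /eqP ->; rewrite inE.
rewrite leq_eqVlt ltnS => /predU1P[E {IH}|/IH H]; last by rewrite !inE H !orbT.
case: i E => m /= E; first by rewrite E !inE eqxx.
by rewrite NegzE -exprnN E !inE eqxx orbT.
Qed.

Lemma dsize_powers (r : rat) n :
  (dsize (encode_seq Num (powers r n)) <= n.+1 * (2 * (n * dsize (Num r) + 4) + 7))%N.
Proof.
rewrite /encode_seq; set M := (2 * _ + 7)%N.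
have H m : (m <= n)%N -> (dsize (dlist (map Num (powers r m))) <= m.+1 * M)%N.
  elim: m => [|m IH] le; first by rewrite mul1n (leq_trans _ (leq_addl _ 7)).
  rewrite mulSn; set q := r ^+ m.+1.
  have E : dsize (dlist (map Num (powers r m.+1))) = (dsize (Num q) +
      (dsize (Num q^-1) + dsize (dlist (map Num (powers r m)))).+1).+1 by [].
  have h1 := dsize_num_inv q; have h2 : (dsize (Num q) <= _)%N := dsize_num_exp r m.+1.
  have h3 : (m.+1 * dsize (Num r) <= n * dsize (Num r))%N by rewrite leq_mul2r le orbT.
  have h4 := IH (ltnW le); rewrite {}E.
  move: h1 h2 h3 h4; rewrite /M; move: (dsize (Num q^-1)) (dsize (Num q)) (dsize (dlist _)).
  by lia.
exact: H.
Qed.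

(** The state holds the threshold, the current power and the powers found so far. No logarithm is
    evaluated: the loop stops at the first power that reaches the threshold. *)
Definition powers_prog (r : rat) : program :=
  Fork (Prim PId) (Const (Pair (Num 1) (encode_seq Num [:: 1]))) ;;
  While (If (Fork Fst (Snd ;; Fst) ;; Prim PLe) (Const (Num 0)) (Const (Num 1)))
    (Fork Fst (Fork (Fork (Snd ;; Fst) (Const (Num r)) ;; Prim PMul) (Snd ;; Snd) ;;
               Fork Fst (Fork Fst (Fork (Fst ;; Prim PInv) Snd)))) ;;
  Snd ;; Snd.

Lemma small_mem (J : Type) (X : eqType) (D : J -> Prop) N (enc : X -> data) (s : J -> seq X) :
  small D N (fun j => encode_seq enc (s j)) ->
  small (fun p : J * X => D p.1 /\ p.2 \in s p.1) (fun p => N p.1) (fun p => enc p.2).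
Proof.
move=> ss.
apply: (@pb_le _ _ _ _ (fun p => dsize (encode_seq enc (s p.1)))) => [[j x] [_ /= xs]|].
  rewrite /encode_seq dsize_dlist big_map (perm_big _ (perm_to_rem xs)) big_cons /=; lia.
by apply: (pb_pull (phi := fst) _ _ ss) => [p []//|]; apply: pb_size.
Qed.

(** [n j], characterised as the least exponent whose power reaches [T j], is the number of rounds;
    the program itself never computes it. *)
Lemma computes_powers (J : Type) (D : J -> Prop) N (r T : J -> rat) (n : J -> nat) :
  small D N (fun j => Num (r j)) -> small D N (fun j => Num (T j)) ->
  poly_bounded D N n ->
  (forall j i, D j -> (T j <= r j ^+ i) = (n j <= i)%N) ->
  computes D N (fun j => powers_prog (r j)) (fun j => Num (T j))
    (fun j => encode_seq Num (powers (r j) (n j))).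
Proof.
move=> sr sT pn TP.
pose S j i := Pair (Num (T j)) (Pair (Num (r j ^+ i)) (encode_seq Num (powers (r j) i))).
have lift_small f (Q : J * nat -> Prop) (QD : forall p, Q p -> D p.1) :
    small D N f -> small Q (fun p => N p.1) (fun p => f p.1) by exact: small_lift.
pose lift_pb (Q : J * nat -> Prop) (QD : forall p, Q p -> D p.1) :
    poly_bounded Q (fun p => N p.1) (fun p => n p.1) :=
  pb_pull QD (pb_size Q (fun p => N p.1)) pn.
have small_pow (Q : J * nat -> Prop) : (forall p, Q p -> D p.1 /\ (p.2 <= n p.1)%N) ->
    small Q (fun p => N p.1) (fun p => Num (r p.1 ^+ p.2)).
  move=> QD; have QD' p : Q p -> D p.1 by case/QD.
  apply: small_exp; first exact: (lift_small _ _ QD' sr).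
  by apply: pb_le (lift_pb _ QD') => p /QD[].
have small_pows (Q : J * nat -> Prop) : (forall p, Q p -> D p.1 /\ (p.2 <= n p.1)%N) ->
    small Q (fun p => N p.1) (fun p => encode_seq Num (powers (r p.1) p.2)).
  move=> QD; have QD' p : Q p -> D p.1 by case/QD.
  have pb2 : poly_bounded Q (fun p => N p.1) snd.
    by apply: pb_le (lift_pb _ QD') => p /QD[].
  apply: pb_le (fun p _ => dsize_powers (r p.1) p.2) _.
  apply: pb_mul (pb_succ pb2) (pb_add (pb_mul (pb_const _ _ 2) _) (pb_const _ _ 7)).
  by apply: pb_add (pb_mul pb2 (lift_small _ _ QD' sr)) (pb_const _ _ 4).
have small_S (Q : J * nat -> Prop) : (forall p, Q p -> D p.1 /\ (p.2 <= n p.1)%N) ->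
    small Q (fun p => N p.1) (fun p => S p.1 p.2).
  move=> QD; have QD' p : Q p -> D p.1 by case/QD.
  apply: small_pair; first exact: lift_small sT.
  by apply: small_pair; [apply: small_pow | apply: small_pows].
have sres : small D N (fun j => encode_seq Num (powers (r j) (n j))).
  have [//|k Hk] := small_pows (fun p => D p.1 /\ p.2 = n p.1).
    by move=> p [Dp ->].
  by exists k => j Dj; apply: (Hk (j, n j)).
have spow : small D N (fun j => Num (r j ^+ n j)) by apply: small_exp.
rewrite /powers_prog; apply: (computes_seq (g := S^~ 0%N)).
  rewrite -[X in computes _ _ _ _ X]/(fun j => Pair (Num (T j)) (Pair (Num 1) (encode_seq Num [:: 1]))).
  by straight_line; solve_small.
apply: (computes_seq (g := fun j => S j (n j))); last first.
  by rewrite /S; straight_line; solve_small.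
apply: (@computes_while _ _ _ _ _ S n) => //.
- apply: (computes_if (b := fun p : J * nat => ~~ (p.2 < n p.1)%N)).
  + pose Q (p : J * nat) := D p.1 /\ (p.2 <= n p.1)%N.
    have QD p : Q p -> D p.1 by case.
    have s1 := lift_small _ _ QD sT; have s2 := small_pow Q (fun p H => H).
    have s3 := small_pows Q (fun p H => H).
    apply: (@computes_ext _ _ _ _ (fun p => S p.1 p.2) _
      (fun p => Num (T p.1 <= r p.1 ^+ p.2)%R%:R)) => [//|p [Dp _]|].
      by rewrite TP // -leqNgt.
    by rewrite /S; straight_line; solve_small.
  + apply: (computes_prim (o := fun=> PConst _)) => [p [_ /negPf ->]//||].
      by apply: small_S => p [[]].
    exact: small_bool.
  + apply: (computes_prim (o := fun=> PConst _)) => [p [_ /negbNE ->]//||].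
      by apply: small_S => p [[]].
    exact: small_bool.
pose Q (p : J * nat) := D p.1 /\ (p.2 < n p.1)%N.
have QD p : Q p -> D p.1 by case.
have QD' p : Q p -> D p.1 /\ (p.2 <= n p.1)%N by case=> ? /ltnW.
have s0 := lift_small _ _ QD sr.
have s1 := lift_small _ _ QD sT; have s2 := small_pow Q QD'; have s3 := small_pows Q QD'.
pose q (p : J * nat) := r p.1 ^+ p.2 * r p.1.
apply: (@computes_ext _ _ _ _ (fun p => S p.1 p.2) _ (fun p => Pair (Num (T p.1))
  (Pair (Num (q p)) (Pair (Num (q p)) (Pair (Num (q p)^-1)
     (encode_seq Num (powers (r p.1) p.2))))))) => [//|p _|].
  by rewrite /q /S -exprSr.
by rewrite /S /q; straight_line; solve_small.
Qed.

(** The reversal reproduces the order in which [foreach] accumulates results, so that the program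
    outputs this very list. *)
Fixpoint vectors (ls L : seq rat) : seq (seq rat) :=
  if ls is l :: ls' then
    catrev (flatten [seq [seq l + p :: v | p <- L] | v <- vectors ls' L]) [::]
  else [:: [::]].

Lemma mem_vectors (ls L : seq rat) v : reflect
  (size v = size ls /\ forall k, (k < size ls)%N -> exists2 p, p \in L & v`_k = ls`_k + p)
  (v \in vectors ls L).
Proof.
apply: (iffP idP).
  elim: ls v => [|l ls IH] v /=; first by rewrite inE => /eqP ->.
  rewrite catrevE cats0 mem_rev => /flatten_mapP[v' /IH[sv Hv] /mapP[p pL ->]].
  by split=> [|[|k]] /=; [rewrite sv | exists p | apply: Hv].
elim: ls v => [|l ls IH] [|x v] //= [] // [sv] H; rewrite catrevE cats0 mem_rev.
apply/flatten_mapP; exists v; first by apply: IH; split=> // k; apply: (H k.+1).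
by have [p pL /= ->] := H 0%N isT; apply/mapP; exists p.
Qed.

(** Body of the inner loop: the environment is [(l, v)], the current element [p], the accumulator
    [u], and the result [(l + p :: v) :: u]. *)
Definition cons_sum : program :=
  Fork (Fork (Fork (Fst ;; Fst) (Snd ;; Fst) ;; Prim PAdd) (Fst ;; Snd)) (Snd ;; Snd).

(** The recursion takes place when the program is built, giving one double loop per coordinate. The
    base value encodes the list whose only entry is the empty vector. *)
Fixpoint vectors_prog (k : nat) : program :=
  if k is k'.+1 then
    Fork (Fork (Fst ;; Fst) Snd)
      (Fork (Fork (Fst ;; Snd) Snd ;; vectors_prog k') (Const (Num 0))) ;;
    foreach (Fork (Fork (Fst ;; Fst) (Snd ;; Fst)) (Fork (Fst ;; Snd) (Snd ;; Snd)) ;;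
             foreach cons_sum)
  else Const (Pair (Num 0) (Num 0)).

Notation encode_vec := (encode_seq Num).

(** Each coordinate adds a double loop that multiplies the number of vectors by the size of [L]. The
    exponent of the bound may grow with [k], which is a constant. *)
Lemma computes_vectors k (J : Type) (D : J -> Prop) N (ls L : J -> seq rat) :
  (forall j, D j -> size (ls j) = k) ->
  small D N (fun j => encode_vec (ls j)) -> small D N (fun j => encode_vec (L j)) ->
  computes D N (fun=> vectors_prog k)
    (fun j => Pair (encode_vec (ls j)) (encode_vec (L j)))
    (fun j => encode_seq encode_vec (vectors (ls j) (L j))).
Proof.
elim: k ls => [|k IH] ls sk sls sL.
  apply: (computes_prim (o := fun=> PConst _)) => [j Dj||].
  - by have /size0nil -> := sk j Dj.
  - exact: small_pair.
  - apply: pb_le (pb_const _ _ 7) => j Dj.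
    by have /size0nil -> := sk j Dj.
pose l j := head 0 (ls j); pose lt j := behead (ls j).
have lsE j : D j -> ls j = l j :: lt j by rewrite /l /lt; case: (ls j) (sk j) => // H /H.
have slt : small D N (fun j => encode_vec (lt j)).
  by apply: pb_le sls => j /lsE ->; rewrite /encode_seq /= leqW ?leq_addl.
have sl : small D N (fun j => Num (l j)).
  by apply: pb_le sls => j /lsE ->; rewrite /encode_seq [leqRHS]/= ltnW // ltnS leq_addr.
have IHt : computes D N (fun=> vectors_prog k)
    (fun j => Pair (encode_vec (lt j)) (encode_vec (L j)))
    (fun j => encode_seq encode_vec (vectors (lt j) (L j))).
  by apply: IH => // j Dj; have := sk j Dj; rewrite lsE //= => -[].
have [_ sV] := computes_small IHt.
apply: (@computes_ext _ _ _ _ (fun j => Pair (Pair (Num (l j)) (encode_vec (lt j)))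
  (encode_vec (L j))) _ (fun j => encode_seq encode_vec (catrev
     (flatten [seq [seq l j + p :: v | p <- L j] | v <- vectors (lt j) (L j)]) [::]))).
- by move=> j /lsE ->.
- by move=> j /lsE ->.
rewrite /=; apply: (computes_seq (g := fun j => Pair (Pair (Num (l j)) (encode_vec (L j)))
  (Pair (encode_seq encode_vec (vectors (lt j) (L j))) (encode_seq encode_vec [::])))).
  apply: computes_fork; first by straight_line; solve_small.
  apply: computes_fork; last by straight_line; solve_small.
  by apply: (computes_seq _ IHt); straight_line; solve_small.
pose D1 (p : J * seq rat) := D p.1 /\ p.2 \in vectors (lt p.1) (L p.1).
have lift1 (f : J -> data) : small D N f -> small D1 (fun p => N p.1) (fun p => f p.1).
  by apply: small_lift => // p [].
have sv : small D1 (fun p => N p.1) (fun p => encode_vec p.2) := small_mem sV.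
have sh : small D1 (fun p => N p.1)
    (fun p => encode_seq encode_vec [seq l p.1 + q :: p.2 | q <- L p.1]).
  have [sl1 sL1] := (lift1 _ sl, lift1 _ sL).
  have -> : (fun p : J * seq rat => encode_seq encode_vec [seq l p.1 + q :: p.2 | q <- L p.1]) =
      (fun p => encode_seq encode_vec (flatten [seq [:: l p.1 + q :: p.2] | q <- L p.1])).
    by apply/funext => p; rewrite flatten_map1.
  apply: (@small_flatten _ _ _ _ _ _ (fun p => L p.1) (fun p q => [:: l p.1 + q :: p.2])).
    pose D2 (p : J * seq rat * rat) := D1 p.1 /\ p.2 \in L p.1.1.
    have lift2 (f : J * seq rat -> data) : small D1 (fun p => N p.1) f ->
        small D2 (fun p => N p.1.1) (fun p => f p.1).
      by apply: small_lift => // p [].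
    have sq : small D2 (fun p => N p.1.1) (fun p => Num p.2) := small_mem sL1.
    have [sl2 sv2] := (lift2 _ sl1, lift2 _ sv).
    by rewrite /encode_seq /=; solve_small.
  by apply: pb_le sL1 => p _; rewrite -(size_map Num); apply: size_le_dsize.
apply: (computes_foreach [::] _ _ _ sh); [by solve_small..|].
rewrite -/D1.
(* The accumulator of the outer loop is arbitrary here, so its size enters the measure of the inner
   loop. *)
pose N1 (p : J * seq rat * seq (seq rat)) := (N p.1.1 + dsize (encode_seq encode_vec p.2))%N.
pose E1 (p : J * seq rat * seq (seq rat)) := D1 p.1.
have liftE (f : J * seq rat -> data) : small D1 (fun p => N p.1) f ->
    small E1 N1 (fun p => f p.1).
  by apply: small_lift => // p; apply: leq_addr.
have su : small E1 N1 (fun p => encode_seq encode_vec p.2).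
  by apply: pb_le (pb_size _ N1) => p _; apply: leq_addl.
have [slE [sLE svE]] := (liftE _ (lift1 _ sl), (liftE _ (lift1 _ sL), liftE _ sv)).
apply: (computes_seq (g := fun p => Pair (Pair (Num (l p.1.1)) (encode_vec p.1.2))
  (Pair (encode_vec (L p.1.1)) (encode_seq encode_vec p.2)))).
  by straight_line; solve_small.
have -> : (fun p : J * seq rat * seq (seq rat) => encode_seq encode_vec
      (catrev [seq l p.1.1 + q :: p.1.2 | q <- L p.1.1] p.2)) =
    (fun p => encode_seq encode_vec
      (catrev (flatten [seq [:: l p.1.1 + q :: p.1.2] | q <- L p.1.1]) p.2)).
  by apply/funext => p; rewrite flatten_map1.
apply: (@computes_foreach _ _ Num encode_vec _ _ _ (fun p => L p.1.1)
  (fun p q => [:: l p.1.1 + q :: p.1.2]) 0); [by solve_small..| |].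
- have slt1 := @small_lift _ _ _ _ _ (fun p => N1 p.1) (fun p => p.1) _
    (fun p (H : E1 p.1 /\ p.2 \in L p.1.1.1) => H.1) (fun p => leqnn _).
  have sq := small_mem sLE.
  have [sl2 sv2] := (slt1 _ slE, slt1 _ svE).
  by rewrite /encode_seq /=; solve_small.
pose D3 (p : J * seq rat * seq (seq rat) * rat * seq (seq rat)) :=
  E1 p.1.1 /\ p.1.2 \in L p.1.1.1.1.
pose N3 (p : J * seq rat * seq (seq rat) * rat * seq (seq rat)) :=
  (N1 p.1.1 + dsize (encode_seq encode_vec p.2))%N.
have lift3 f : small E1 N1 f -> small D3 N3 (fun p => f p.1.1).
  by apply: small_lift => [p []//|p]; apply: leq_addr.
have sq : small D3 N3 (fun p => Num p.1.2).
  apply: (small_lift (phi := fun p => p.1) _ _ (small_mem sLE)) => [p []//|p].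
  exact: leq_addr.
have sw : small D3 N3 (fun p => encode_seq encode_vec p.2).
  by apply: pb_le (pb_size _ N3) => p _; apply: leq_addl.
have [sl3 sv3] := (lift3 _ slE, lift3 _ svE).
have sc : small D3 N3 (fun p => encode_vec (l p.1.1.1.1 + p.1.2 :: p.1.1.1.2)).
  by rewrite /encode_seq /=; solve_small.
rewrite -/D3 -/N3 /cons_sum.
apply: (@computes_ext _ _ _ _ _ _ (fun p => Pair (encode_vec (l p.1.1.1.1 + p.1.2 ::
  p.1.1.1.2)) (encode_seq encode_vec p.2)) _ (fun _ _ => erefl) (fun _ _ => erefl)).
rewrite /encode_seq /= in sc *.
by straight_line; solve_small.
Qed.

(** * Polynomial time *)

(** Choice turns the outputs, known only to exist, into a function of the index, as [computes]
    requires. *)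
Lemma halting_computes (J : Type) (D : J -> Prop) N (A : J -> program) f T
    (Q : J -> data -> Prop) :
  poly_bounded D N T ->
  (forall j, D j -> exists w t, run (A j) (f j) w t /\ Q j w) ->
  (forall j w t, D j -> run (A j) (f j) w t -> (t <= T j)%N) ->
  exists g, computes D N A f g /\ forall j, D j -> Q j (g j).
Proof.
move=> pT hA tA.
have [j|g gP] := @choice J data
    (fun j w => D j -> exists2 t, run (A j) (f j) w t & Q j w).
  have [Dj|nDj] := pselect (D j); last by exists (f j).
  by have [w [t [r q]]] := hA j Dj; exists w => _; exists t.
exists g; split=> [|j /gP[]//]; exists T; split=> // j Dj.
by have [t r _] := gP j Dj; exists t => //; apply: tA r.
Qed.

Section PolynomialTime.
Variable R : realType.

(** Horner's scheme, with every real coefficient replaced by a natural number above its absolute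
    value; at nonnegative points this can only increase the value. *)
Lemma horner_bound (p : {poly R}) (J : Type) (D : J -> Prop) N (x : J -> nat) :
  poly_bounded D N x ->
  exists2 f, poly_bounded D N f & forall j, D j -> p.[(x j)%:R] <= (f j)%:R.
Proof.
move=> px; elim/poly_ind: p => [|q c [f pf fP]].
  by exists (fun=> 0%N) => [|j _]; [exact: pb_const | rewrite horner0].
exists (fun j => f j * x j + Num.bound `|c|)%N.
  by apply: pb_add (pb_const _ _ _); apply: pb_mul.
move=> j Dj; rewrite hornerMXaddC natrD natrM; apply: lerD; first exact/ler_wpM2r/fP.
exact: le_trans (ler_norm c) (ltW (archi_boundP (normr_ge0 c))).
Qed.

Lemma hornerXY_bound (p : {poly {poly R}}) (J : Type) (D : J -> Prop) N (x y : J -> nat) :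
  poly_bounded D N x -> poly_bounded D N y ->
  exists2 f, poly_bounded D N f & forall j, D j -> p.[(x j)%:R, (y j)%:R] <= (f j)%:R.
Proof.
move=> px py; elim/poly_ind: p => [|q c [f pf fP]].
  by exists (fun=> 0%N) => [|j _]; [exact: pb_const | rewrite !horner0].
have [g pg gP] := horner_bound c py.
exists (fun j => f j * x j + g j)%N; first by apply: pb_add => //; apply: pb_mul.
move=> j Dj; rewrite hornerMXaddC hornerD hornerM hornerC natrD natrM.
by apply: lerD; [exact/ler_wpM2r/fP | exact: gP].
Qed.

Lemma polytime_computes A (D : set data) (Q : data -> data -> Prop) :
  halts_with A D Q -> polytime R A D ->
  exists g, computes D dsize (fun=> A) id g /\ forall v, D v -> Q v (g v).
Proof.
move=> hA [p pA]; have [f pf fP] := horner_bound p (pb_size D dsize).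
apply: (halting_computes pf hA) => v w t Dv r.
by rewrite -(ler_nat R); apply: le_trans (pA _ _ _ Dv r) (fP v Dv).
Qed.

End PolynomialTime.

(** * The grid program *)

Lemma bernoulli (F : numDomainType) (x : F) n : 0 <= x -> 1 + n%:R * x <= (1 + x) ^+ n.
Proof.
move=> x0; elim: n => [|n IH]; first by rewrite mul0r addr0 expr0.
rewrite exprS; apply: le_trans (_ : (1 + x) * (1 + n%:R * x) <= _); last first.
  by rewrite ler_wpM2l // addr_ge0.
by rewrite -natr1 !mulrDl !mulrDr !mul1r !mulr1 !addrA lerDl !mulr_ge0.
Qed.

Lemma small_nat (J : Type) (D : J -> Prop) N (n : J -> nat) :
  poly_bounded D N n -> small D N (fun j => Num (n j)%:R).
Proof.
move=> pn; apply: pb_le (pb_add pn (pb_const _ _ 3)) => j _.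
rewrite /= -[(n j)%:R]/((n j)%:Z%:~R) numq_int denq_int /nbits /=.
have : (trunc_log 2 (n j) <= n j)%N.
  by case: (n j) => // m; apply/ltnW/trunc_log_lt => //; apply: ltn_expl.
rewrite (_ : trunc_log 2 1 = 0%N) //; lia.
Qed.

Fixpoint pow_prog (k : nat) : program :=
  if k is k'.+1 then Fork (Prim PId) (pow_prog k') ;; Prim PMul else Const (Num 1).

Lemma computes_pow (J : Type) (D : J -> Prop) N (y : J -> rat) k :
  small D N (fun j => Num (y j)) ->
  computes D N (fun=> pow_prog k) (fun j => Num (y j)) (fun j => Num (y j ^+ k)).
Proof.
move=> sy; elim: k => [|k IH] /=.
  have -> : (fun j => Num (y j ^+ 0)) = fun=> Num 1 by [].
  by straight_line; solve_small.
have [_ sk] := computes_small IH.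
apply: (@computes_ext _ _ _ _ (fun j => Num (y j)) _ (fun j => Num (y j * y j ^+ k))).
- by [].
- by move=> j _; rewrite exprS.
apply: (computes_seq (g := fun j => Pair (Num (y j)) (Num (y j ^+ k)))).
  by apply: computes_fork IH; straight_line; solve_small.
by straight_line; solve_small.
Qed.

Section GridProgram.
Variables (K : nat) (eps alpha : rat) (lmin_prog bounds_prog alg : program).

(** This is [beta / eps'], the part of [1 / c] that does not depend on the instance. *)
Definition threshold_factor : rat := (1 + eps / 2) * alpha * (eps / 2)^-1.

Definition threshold_prog : program :=
  Fork (Fork Snd (Fst ;; Prim PInv) ;; Prim PMul) (Const (Num threshold_factor)) ;;
  Prim PMul ;; pow_prog K ;;
  Fork (Prim PId) (Const (Num K.+1`!%:R)) ;; Prim PMul.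

Definition grid_prog : program :=
  Fork (Prim PId) (Fork lmin_prog
    (bounds_prog ;; threshold_prog ;; powers_prog (1 + eps / 2))) ;;
  Fork Fst (Fork (Snd ;; vectors_prog K) (Const (Num 0))) ;;
  foreach (Fork (Fork Fst (Snd ;; Fst) ;; alg) (Snd ;; Snd)).

End GridProgram.

(* (K+1)! / c^K, see [ratr_threshold]. *)
Definition threshold (K : nat) (eps alpha LB UB : rat) : rat :=
  (UB * LB^-1 * threshold_factor eps alpha) ^+ K * K.+1`!%:R.

Lemma computes_grid (J : Type) (D : J -> Prop) N (K : nat) (I : J -> data) (ls : J -> seq rat)
    (LB UB eps alpha : J -> rat) (n : J -> nat)
    (lmin_prog bounds_prog : program) (alg : J -> program) (out : J -> seq rat -> data) :
  small D N (fun j => Num (eps j)) -> small D N (fun j => Num (alpha j)) ->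
  computes D N (fun=> lmin_prog) I (fun j => encode_vec (ls j)) ->
  (forall j, D j -> size (ls j) = K) ->
  computes D N (fun=> bounds_prog) I (fun j => Pair (Num (LB j)) (Num (UB j))) ->
  poly_bounded D N n ->
  (forall j i, D j -> (threshold K (eps j) (alpha j) (LB j) (UB j) <= (1 + eps j / 2) ^+ i)
     = (n j <= i)%N) ->
  let V j := vectors (ls j) (powers (1 + eps j / 2) (n j)) in
  computes (fun p : J * seq rat => D p.1 /\ p.2 \in V p.1)
    (fun p => N p.1 + dsize (encode_vec p.2))%N
    (fun p => alg p.1) (fun p => Pair (I p.1) (encode_vec p.2)) (fun p => out p.1 p.2) ->
  computes D N (fun j => grid_prog K (eps j) (alpha j) lmin_prog bounds_prog (alg j)) I
    (fun j => dlist (rev [seq out j v | v <- V j])).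
Proof.
move=> seps salpha Hl szl Hb pn thr V Halg0.
have [sI sl] := computes_small Hl.
have [_ sb] := computes_small Hb.
have sLB : small D N (fun j => Num (LB j)) := small_fst sb.
have sUB : small D N (fun j => Num (UB j)) := small_snd sb.
have sr : small D N (fun j => Num (1 + eps j / 2)) by solve_small.
have sf : small D N (fun j => Num (threshold_factor (eps j) (alpha j))).
  by rewrite /threshold_factor; solve_small.
have sy : small D N (fun j => Num (UB j * (LB j)^-1 * threshold_factor (eps j) (alpha j))).
  by solve_small.
have Hp := computes_pow K sy; have [_ sp] := computes_small Hp.
have sT : small D N (fun j => Num (threshold K (eps j) (alpha j) (LB j) (UB j))).
  by rewrite /threshold; solve_small.
have HT : computes D N (fun j => threshold_prog K (eps j) (alpha j))
    (fun j => Pair (Num (LB j)) (Num (UB j)))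
    (fun j => Num (threshold K (eps j) (alpha j) (LB j) (UB j))).
  rewrite /threshold_prog /threshold.
  apply: (computes_seq (g := fun j => Pair (Num (UB j * (LB j)^-1))
     (Num (threshold_factor (eps j) (alpha j))))); first by straight_line; solve_small.
  eapply computes_seq; first by straight_line; solve_small.
  apply: (computes_seq Hp).
  by straight_line; solve_small.
have HP := computes_powers sr sT pn thr; have [_ sP] := computes_small HP.
have HV := computes_vectors szl sl sP; have [_ sV] := computes_small HV.
(* Grid vectors have polynomial length, so the time of [alg], stated in terms of that length, is
   polynomial in [N] alone. *)
have Halg : computes (fun p : J * seq rat => D p.1 /\ p.2 \in V p.1) (fun p => N p.1)
    (fun p => alg p.1) (fun p => Pair (I p.1) (encode_vec p.2)) (fun p => out p.1 p.2).
  apply: (computes_pull (phi := id) _ _ Halg0) => //.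
  exact: pb_add (pb_size _ _) (small_mem sV).
have [_ sout] := computes_small Halg.
rewrite /grid_prog; apply: (computes_seq (g := fun j => Pair (I j) (Pair (encode_vec (ls j))
    (encode_vec (powers (1 + eps j / 2) (n j)))))).
  apply: computes_fork; first by straight_line; solve_small.
  apply: computes_fork => //.
  exact: (computes_seq Hb (computes_seq HT HP)).
apply: (computes_seq (g := fun j => Pair (I j) (Pair (encode_seq encode_vec (V j))
    (encode_seq id [::])))).
  apply: computes_fork; first by straight_line; solve_small.
  apply: computes_fork; last by straight_line; solve_small.
  by eapply computes_seq; [straight_line; solve_small | exact: HV].
apply: (@computes_ext _ _ _ _ _ _ (fun j => encode_seq id (catrev
    (flatten [seq [:: out j v] | v <- V j]) [::])) _ (fun _ _ => erefl)).
  by move=> j _; rewrite /encode_seq map_id catrevE cats0 flatten_map1.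
apply: (@computes_foreach _ _ encode_vec id _ _ _ V (fun j v => [:: out j v]) [::]) => //.
- exact: small_const.
- by rewrite /encode_seq /=; solve_small.
pose D1 (p : J * seq rat * seq data) := D p.1.1 /\ p.1.2 \in V p.1.1.
pose N1 (p : J * seq rat * seq data) := (N p.1.1 + dsize (encode_seq id p.2))%N.
have le1 p : (N p.1.1 <= N1 p)%N by apply: leq_addr.
have sI1 : small D1 N1 (fun p => I p.1.1).
  by apply: (small_lift (phi := fun p => p.1.1) _ le1 sI) => p [].
have sv1 : small D1 N1 (fun p => encode_vec p.1.2).
  exact: (small_lift (phi := fun p => p.1) _ le1 (small_mem sV)).
have su1 : small D1 N1 (fun p => encode_seq id p.2).
  by apply: pb_le (pb_size _ N1) => p _; apply: leq_addl.
have Halg1 : computes D1 N1 (fun p => alg p.1.1)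
    (fun p => Pair (I p.1.1) (encode_vec p.1.2)) (fun p => out p.1.1 p.1.2).
  apply: (computes_pull (phi := fun p => p.1) _ _ Halg) => //.
  by apply: pb_le (pb_size _ N1) => p _; apply: le1.
apply: (computes_fork (g := fun p => out p.1.1 p.1.2)).
  by eapply computes_seq; [straight_line; solve_small | exact: Halg1].
by straight_line; solve_small.
Qed.

(** * Correctness and running time *)

Section Threshold.
Variables (R : realType) (K : nat) (LB UB : data -> rat) (eps alpha : rat) (I : data).
Hypotheses (eps0 : 0 < eps) (eps1 : eps < 1) (alpha1 : 1 <= alpha).
Hypothesis LU : 0 < LB I <= UB I.
Let T : rat := threshold K eps alpha (LB I) (UB I).
Let alphaR1 : 1 <= ratr alpha :> R. Proof. by rewrite -(rmorph1 (@ratr R)) ler_rat. Qed.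
Let n : nat := `|grid_ub K LB UB eps (ratr alpha : R) I|%N.
Let r1 : 1 < 1 + ratr eps / 2 :> R.
Proof. by rewrite ltrDl divr_gt0 // ltr0q. Qed.

Lemma ratr_threshold :
  ratr T = K.+1`!%:R / grid_c LB UB eps (ratr alpha : R) I ^+ K.
Proof.
rewrite /T /threshold rmorphM rmorph_nat mulrC; congr (_ * _).
rewrite -exprVn rmorphXn /grid_c /grid_beta /threshold_factor; congr (_ ^+ _).
rewrite !rmorphM !fmorphV rmorphM fmorphV rmorphD rmorph1 rmorphM fmorphV rmorph_nat.
have e0 : ratr eps != 0 :> R by rewrite fmorph_eq0 gt_eqF.
have l0 : ratr (LB I) != 0 :> R by rewrite fmorph_eq0 gt_eqF //; case/andP: LU.
by rewrite [RHS]invf_div; field; rewrite l0 e0.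
Qed.

Lemma ratr_threshold_ge1 : 1 <= ratr T :> R.
Proof.
have /andP[c0 c1] := grid_c_itv eps0 eps1 alphaR1 LU.
rewrite ratr_threshold ler_pdivlMr ?exprn_gt0 // mul1r.
by apply: le_trans (exprn_ile1 _ (ltW c0) c1) _; rewrite ler1n fact_gt0.
Qed.

Let T0 : 0 < ratr T :> R := lt_le_trans ltr01 ratr_threshold_ge1.

Lemma grid_ub_nat : grid_ub K LB UB eps (ratr alpha : R) I = n.
Proof.
rewrite /n gez0_abs // /grid_ub -ratr_threshold ceil_ge0 (lt_le_trans (ltrN10 _)) //.
by rewrite divr_ge0 // ln_ge0 ?ratr_threshold_ge1 // ltW.
Qed.

Lemma grid_lb_nat : grid_lb K LB UB eps (ratr alpha : R) I = - n%:Z.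
Proof.
rewrite -grid_ub_nat /grid_lb /grid_ub -[X in logb _ X]invrK invf_div -ratr_threshold.
by rewrite logbV // ceilNfloor opprK.
Qed.

Lemma threshold_le_exp i : (T <= (1 + eps / 2) ^+ i) = (n <= i)%N.
Proof.
rewrite -(ler_rat R) rmorphXn rmorphD rmorph1 fmorph_div rmorph_nat /=.
rewrite -[_ ^+ i]/(_ ^ (i%:Z)) -(ceil_logb_le r1) // -lez_nat -grid_ub_nat.
by rewrite /grid_ub -ratr_threshold.
Qed.

(** By Bernoulli's inequality [2 * m] factors [1 + eps / 2] make at least 2, and [2 ^ dsize (Num T)]
    is at least [T]. *)
Lemma grid_ub_le m : eps = m%:R^-1 -> (n <= 2 * m * dsize (Num T))%N.
Proof.
move=> epsE; have m0 : 0 < m%:R :> rat by rewrite -invr_gt0 -epsE.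
rewrite -threshold_le_exp; apply: le_trans (rat_le_dsize _) _.
have h0 : 0 <= 1 + eps / 2 by rewrite addr_ge0 // divr_ge0 // ltW.
rewrite natrX exprM; apply: lerXn2r; rewrite ?nnegrE ?exprn_ge0 //.
apply: le_trans (bernoulli (2 * m) _); last by rewrite divr_ge0 // ltW.
by rewrite epsE natrM -mulrA mulVKf ?gt_eqF // divff.
Qed.

End Threshold.

(** * Correctness of the grid program *)

Section Correctness.
Variables (R : realType) (K : nat) (P : problem R K).
Variables (lmin : data -> 'rV[R]_K) (LB UB : data -> rat).

(** The summand 2 keeps the accuracy strictly below 1 for large [e] too; the inverse of a natural
    number is rational, as programs require. *)
Definition accuracy_inv (e : R) : nat := (Num.truncn (3 / e)).+2.
Definition accuracy (e : R) : rat := (accuracy_inv e)%:R^-1.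

Lemma accuracy_itv e : 0 < accuracy e < 1.
Proof. by rewrite /accuracy invr_gt0 ltr0n invf_lt1 ?ltr1n ?ltr0n. Qed.

Lemma accuracy_le e : 0 < e -> 3 * ratr (accuracy e) <= e.
Proof.
move=> e0; rewrite fmorphV rmorph_nat ler_pdivrMr ?ltr0n // mulrC -ler_pdivrMr //.
have /truncn_itv/andP[_ /ltW /le_trans -> //] : 0 <= 3 / e by rewrite divr_ge0 // ltW.
by rewrite ler_nat.
Qed.

Lemma dvec_encode (q : 'rV[rat]_K) : dvec q = encode_vec [seq q 0 k | k <- enum 'I_K].
Proof. by rewrite /dvec /encode_seq -map_comp. Qed.

Lemma encode_dvec (v : seq rat) : size v = K -> encode_vec v = dvec (\row_(k < K) v`_k).
Proof.
move=> sv; rewrite dvec_encode; congr encode_seq.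
apply: (@eq_from_nth _ 0); first by rewrite size_map size_enum_ord.
move=> i; rewrite sv => iK; rewrite (nth_map (Ordinal iK)) ?size_enum_ord // mxE.
by rewrite nth_enum_ord.
Qed.

Hypotheses (ha : assumption_a P lmin) (hc : assumption_c P lmin LB UB).

(* E is the set of all e > 0 for the FPTAS, where the bounds have to be uniform in
   e, and a singleton for the PTAS. *)
Lemma grid_prog_spec : exists lmin_prog bounds_prog : program,
  forall (E : R -> Prop) (al : R -> rat) (ALG : R -> program) (T : R * data -> nat),
  (forall e, E e -> 1 <= al e) -> small E accuracy_inv (fun e => Num (al e)) ->
  (forall e, E e -> nonparam_alg P (ratr (al e)) (ALG e)) ->
  poly_bounded (fun p => E p.1 /\ nonparam_inputs P p.2)
    (fun p => accuracy_inv p.1 + dsize p.2)%N T ->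
  (forall e v w t, E e -> nonparam_inputs P v -> run (ALG e) v w t -> (t <= T (e, v))%N) ->
  let G e := grid_prog K (accuracy e) (al e) lmin_prog bounds_prog (ALG e) in
  (forall e, E e ->
     is_grid_algorithm P lmin LB UB (accuracy e) (ratr (al e)) (ALG e) (G e)) /\
  exists k, forall e I w t, E e -> instance P I -> run (G e) I w t ->
    (t <= (accuracy_inv e + dsize I).+2 ^ k)%N.
Proof.
case: ha => paramsE [lmin_prog [Hl Tl]]; case: hc => LUP [bounds_prog [Hb Tb]].
exists lmin_prog, bounds_prog => E al ALG T al1 sal algP pT TP G.
have [lm [Cl lmP]] := polytime_computes Hl Tl.
have [bd [Cb bdP]] := polytime_computes Hb Tb.
(* [lq I] is the rational vector behind [lmin I]; 0 is the default outside the instances. *)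
have [I|lq lqP] := @choice data 'rV[rat]_K
    (fun I q => instance P I -> lm I = dvec q /\ map_mx ratr q = lmin I).
  have [II|nI] := pselect (instance P I); last by exists 0.
  by have [q -> qE] := lmP I II; exists q.
have [out [Cout _]] : exists out, computes (fun p => E p.1 /\ nonparam_inputs P p.2)
    (fun p => accuracy_inv p.1 + dsize p.2)%N (fun p => ALG p.1) snd out /\
    forall p, E p.1 /\ nonparam_inputs P p.2 -> True.
  apply: (halting_computes (Q := fun _ _ => True) pT) => [p [Ep vp]|[e v] w t [Ee vv]].
    by have [w [t [r _]]] := algP _ Ep _ vp; exists w, t.
  exact: TP.
pose D (p : R * data) := E p.1 /\ instance P p.2.
pose N (p : R * data) := (accuracy_inv p.1 + dsize p.2)%N.
pose n (p : R * data) := `|grid_ub K LB UB (accuracy p.1) (ratr (al p.1) : R) p.2|%N.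
pose ls I := [seq lq I 0 k | k <- enum 'I_K].
pose r (p : R * data) := 1 + accuracy p.1 / 2.
pose V p := vectors (ls p.2) (powers (r p) (n p)).
have szls I : size (ls I) = K by rewrite size_map size_enum_ord.
have lsE I (k : 'I_K) : (ls I)`_k = lq I 0 k.
  by rewrite (nth_map k) ?size_enum_ord // nth_ord_enum.
have pN1 : poly_bounded D N (fun p => accuracy_inv p.1).
  by apply: pb_le (pb_size _ N) => p _; apply: leq_addr.
have pN2 : poly_bounded D N (fun p => dsize p.2).
  by apply: pb_le (pb_size _ N) => p _; apply: leq_addl.
have seps : small D N (fun p => Num (accuracy p.1)) by apply/small_inv/small_nat.
have sal1 : small D N (fun p => Num (al p.1)).
  by apply: (pb_pull (phi := fst) _ _ sal) => // p [].
have Cl1 : computes D N (fun=> lmin_prog) snd (fun p => encode_vec (ls p.2)).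
  apply: (computes_ext (fun _ _ => erefl) _
    (computes_pull (phi := snd) (fun p (H : D p) => H.2) pN2 Cl)) => p [_ Ip].
  by have [-> _] := lqP _ Ip; rewrite dvec_encode.
have Cb1 : computes D N (fun=> bounds_prog) snd
    (fun p => Pair (Num (LB p.2)) (Num (UB p.2))).
  apply: (computes_ext (fun _ _ => erefl) _
    (computes_pull (phi := snd) (fun p (H : D p) => H.2) pN2 Cb)) => p [_ Ip].
  by rewrite bdP.
have LU p : D p -> 0 < LB p.2 <= UB p.2 by case=> _ /LUP[].
have acc0 e : 0 < accuracy e by case/andP: (accuracy_itv e).
have acc1 e : accuracy e < 1 by case/andP: (accuracy_itv e).
have pn : poly_bounded D N n.
  apply: (@pb_le _ _ _ _ (fun p => 2 * accuracy_inv p.1 *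
    dsize (Num (threshold K (accuracy p.1) (al p.1) (LB p.2) (UB p.2))))%N) => [p Dp|].
    by apply: grid_ub_le => //; [apply: al1; case: Dp | exact: LU].
  apply: pb_mul; first by apply: pb_mul (pb_const _ _ _) pN1.
  have [_ sb] := computes_small Cb1.
  have sLB : small D N (fun p => Num (LB p.2)) := small_fst sb.
  have sUB : small D N (fun p => Num (UB p.2)) := small_snd sb.
  rewrite /threshold; apply: small_mul; last exact: small_const.
  apply: small_exp; last exact: pb_const.
  by rewrite /threshold_factor; solve_small.
have thr p i : D p -> (threshold K (accuracy p.1) (al p.1) (LB p.2) (UB p.2) <=
    r p ^+ i) = (n p <= i)%N.
  by move=> Dp; apply: threshold_le_exp => //; [apply: al1; case: Dp | exact: LU].
have ratr_r p : ratr (r p) = 1 + ratr (accuracy p.1) / 2 :> R.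
  by rewrite /r rmorphD rmorph1 fmorph_div rmorph_nat.
have r0 p : 0 < r p by rewrite addr_gt0 // divr_gt0.
have rX p (i : int) : ratr (r p ^ i) = (1 + ratr (accuracy p.1) / 2) ^ i :> R.
  by rewrite -ratr_r rmorphXz // unitfE gt_eqF.
(* Powers of [r p] are nonnegative, so the enumerated vectors lie in the parameter set and [ALG]
   halts on them. *)
have Vinput p v : D p -> v \in V p -> nonparam_inputs P (Pair p.2 (encode_vec v)).
  move=> [Ep Ip] /mem_vectors; rewrite szls => -[sv vP].
  exists p.2, (\row_k v`_k); split=> //; first by rewrite encode_dvec.
  rewrite paramsE //= => k; have [_ <-] := lqP _ Ip; rewrite !mxE ler_rat.
  have [x /mem_powers[i _ ->] ->] := vP k (ltn_ord k).
  by rewrite lsE lerDl exprz_ge0 // ltW.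
have Calg : computes (fun q : (R * data) * seq rat => D q.1 /\ q.2 \in V q.1)
    (fun q => N q.1 + dsize (encode_vec q.2))%N (fun q => ALG q.1.1)
    (fun q => Pair q.1.2 (encode_vec q.2))
    (fun q => out (q.1.1, Pair q.1.2 (encode_vec q.2))).
  apply: (computes_pull (phi := fun q : (R * data) * seq rat =>
    (q.1.1, Pair q.1.2 (encode_vec q.2))) _ _ Cout) => [q [Dq vq]|].
    by split; [case: Dq | apply: Vinput vq].
  by apply: pb_le (pb_succ (pb_size _ _)) => q _; rewrite /N /=; lia.
have C := computes_grid (alg := fun p => ALG p.1) (out := fun p v => out (p.1, Pair p.2 (encode_vec v)))
  seps sal1 Cl1 (fun p _ => szls p.2) Cb1 pn thr Calg.
have [T' [[k pT'] CT]] := C.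
split; last first.
  exists k => e I w t Ee II rw.
  have [t' r' le'] := CT (e, I) (conj Ee II).
  have [_ ->] := run_det rw r'.
  exact: leq_trans le' (pT' (e, I) (conj Ee II)).
move=> e Ee; split; first exact: accuracy_itv.
move=> I II; have Dp : D (e, I) by [].
have [t rw _] := CT (e, I) Dp.
exists (dlist (rev [seq out (e, Pair I (encode_vec v)) | v <- V (e, I)])), t.
split; first exact: rw.
exists (rev [seq out (e, Pair I (encode_vec v)) | v <- V (e, I)]) => //.
have [_ lqE] := lqP _ II.
have itvE i : (grid_lb K LB UB (accuracy e) (ratr (al e) : R) I <= i <=
    grid_ub K LB UB (accuracy e) (ratr (al e) : R) I)%R = (`|i| <= n (e, I))%N.
  have LUI := LU _ Dp; have ae := al1 e Ee.
  by rewrite grid_lb_nat // grid_ub_nat // /n /=; lia.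
have run_out v : v \in V (e, I) -> exists t, run (ALG e) (Pair I (encode_vec v))
    (out (e, Pair I (encode_vec v))) t.
  move=> vV; have [T0 [_ /(_ (e, Pair I (encode_vec v)))]] := Cout.
  by case=> [|t0 rt0 _]; [split=> //; apply: (Vinput (e, I)) | exists t0].
apply/seteqP; split=> x /=.
  (* From the program to the grid: an exponent is chosen for each coordinate of the listed
     vector. *)
  rewrite mem_rev => /mapP[v vV ->].
  have [t0 rt0] := run_out v vV.
  move: (vV) => /mem_vectors; rewrite szls => -[sv vP].
  have [k0|i iP] := @choice 'I_K int (fun k i => (`|i| <= n (e, I))%N /\
      v`_k = lq I 0 k + r (e, I) ^ i).
    have [x' /mem_powers[i le ->] ->] := vP k0 (ltn_ord k0).
    by exists i; rewrite lsE.
  exists i; split; first by move=> k0; rewrite itvE; case: (iP k0).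
  exists (\row_k v`_k), t0; split; last by rewrite -encode_dvec.
  apply/rowP => k0; rewrite !mxE -lqE mxE; case: (iP k0) => _ ->.
  by rewrite rmorphD /= rX.
(* Conversely, injectivity of [ratr] identifies the rational vector of a grid point with an
   enumerated one, and determinism identifies the outputs. *)
move=> [i [ile [q [t0 [qE rt0]]]]]; rewrite mem_rev.
have qV : [seq q 0 k | k <- enum 'I_K] \in V (e, I).
  apply/mem_vectors; rewrite szls size_map size_enum_ord; split=> // m mK.
  pose k0 := Ordinal mK; exists (r (e, I) ^ i k0).
    by apply/mem_powers; exists (i k0); rewrite -?itvE.
  rewrite -[m]/(val k0) lsE (nth_map k0) ?size_enum_ord // nth_ord_enum.
  apply: (fmorph_inj (@ratr R)); have /rowP/(_ k0) := qE.
  by rewrite !mxE -lqE mxE rmorphD /= rX.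
apply/mapP; exists [seq q 0 k | k <- enum 'I_K] => //.
have [t1 rt1] := run_out _ qV; rewrite dvec_encode in rt0.
by have [-> _] := run_det rt0 rt1.
Qed.
End Correctness.

(** * From the grid algorithm to approximation schemes *)

Section Schemes.
Variables (R : realType) (K : nat) (P : problem R K).
Variables (lmin : data -> 'rV[R]_K) (LB UB : data -> rat).
Hypotheses (ha : assumption_a P lmin) (hc : assumption_c P lmin LB UB).

(** Nonnegativity allows an approximation factor to be enlarged. *)
Lemma objective_ge0 I x l : instance P I -> feasible P I x -> params P I l ->
  0 <= objective P I x l.
Proof.
case: ha => paramsE _; case: hc => LUP _ II xf; rewrite paramsE // => lP.
have [/andP[L0 _] /(_ x xf)[ob bb]] := LUP I II.
have ge0 y : zero_or_between (LB I) (UB I) y -> 0 <= y :> R.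
  by case=> [->//|/andP[/(le_trans _) + _]]; apply; rewrite ler0q ltW.
rewrite (objective_shift P I x l (lmin I)); apply: addr_ge0; first exact: ge0.
apply: sumr_ge0 => k _.
by rewrite mulr_ge0 ?subr_ge0 ?ge0.
Qed.

Lemma is_grid_algorithm_approx (eps : rat) (alpha b : R) ALG G :
  1 <= alpha -> (1 + ratr eps) * alpha <= b -> nonparam_alg P alpha ALG ->
  is_grid_algorithm P lmin LB UB eps alpha ALG G ->
  halts_with G (instance P) (fun I w => exists2 s : seq data,
    w = dlist s & approximation_set P b I [set` s]%classic).
Proof.
move=> a1 ab algP [/andP[e0 e1] GP] I II.
case: (ha) => paramsE [A [AP _]]; case: (hc) => /(_ I II)[LU vals] _.
have [_ [_ [_ [q _ qE]]]] := AP I II.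
have [w [t [rw [s wE sE]]]] := GP I II.
exists w, t; split=> //; exists s => //; split; first exact: finite_seq.
  by rewrite sE; apply: grid_output_feasible => //; apply: paramsE.
move=> l lP; rewrite sE.
have [x xS xP] := grid_output_approx e0 e1 a1 qE (paramsE I II) LU vals II algP lP.
exists x => // x' x'f; apply: le_trans (xP x' x'f) _.
by rewrite ler_wpM2r // objective_ge0.
Qed.

(** For a fixed accuracy, [c] is a constant and merges into the polynomial. *)
Lemma polytime_exp (G : program) k c :
  (forall I w t, instance P I -> run G I w t -> (t <= (c + dsize I).+2 ^ k)%N) ->
  polytime R G (instance P).
Proof.
move=> GP; exists (('X + c.+2%:R%:P) ^+ k) => I w t II rw.
rewrite horner_exp hornerD hornerX hornerC -natrD -natrX ler_nat.
by rewrite !addnS addnC; apply: GP II rw.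
Qed.

Lemma polytime_family_exp (G : R -> program) k :
  (forall e I w t, 0 < e -> instance P I -> run (G e) I w t ->
     (t <= (accuracy_inv e + dsize I).+2 ^ k)%N) ->
  polytime_family G (instance P).
Proof.
(* The outer variable is the instance size, the inner one [e^-1]; the constant 4 combines the 2 in
   [accuracy_inv e <= 3 / e + 2] with the 2 added in the base of the bound. *)
move=> GP; exists (('X + (3%:P * 'X + 4%:P)%:P) ^+ k) => e e0 I w t II rw.
rewrite !(horner_exp, hornerD, hornerX, hornerC, hornerM).
apply: (@le_trans _ _ ((accuracy_inv e + dsize I).+2 ^ k)%:R).
  by rewrite ler_nat; apply: GP rw.
have /truncn_itv/andP[tr _] : 0 <= 3 / e by rewrite divr_ge0 // ltW.
have -> : ((accuracy_inv e + dsize I).+2 = dsize I + (Num.truncn (3 / e) + 4))%N.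
  by rewrite /accuracy_inv addn4 !addSn !addnS addnC.
rewrite natrX !natrD; apply: lerXn2r; last by rewrite lerD2l lerD2r.
  by rewrite nnegrE !addr_ge0.
by rewrite nnegrE !addr_ge0 // mulr_ge0 // invr_ge0 ltW.
Qed.

End Schemes.

Theorem corollary2p15 (R : realType) (K : nat) (hK : (1 <= K)%N)
    (P : problem R K) (lmin : data -> 'rV[R]_K) (LB UB : data -> rat)
    (ha : assumption_a P lmin) (hb : assumption_b P)
    (hc : assumption_c P lmin LB UB) :
  [/\ forall ALG : program, nonparam_exact P ALG ->
        exists (acc : R -> rat) (G : R -> program),
          (forall e : R, 0 < e ->
             is_grid_algorithm P lmin LB UB (acc e) 1 ALG (G e)) /\
          param_FPTAS P G,
      forall ALG : R -> program, nonparam_FPTAS P ALG ->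
        exists (acc : R -> rat) (del : R -> R) (G : R -> program),
          (forall e : R, 0 < e -> 0 < del e /\
             is_grid_algorithm P lmin LB UB (acc e) (1 + del e)
               (ALG (del e)) (G e)) /\
          param_FPTAS P G
    & forall ALG : R -> program, nonparam_PTAS P ALG ->
        exists (acc : R -> rat) (del : R -> R) (G : R -> program),
          (forall e : R, 0 < e -> 0 < del e /\
             is_grid_algorithm P lmin LB UB (acc e) (1 + del e)
               (ALG (del e)) (G e)) /\
          param_PTAS P G].
Proof.
have [lmin_prog [bounds_prog spec]] := grid_prog_spec ha hc.
pose del (e : R) : R := ratr (accuracy e).
have del0 e : 0 < del e by rewrite ltr0q; case/andP: (accuracy_itv e).
(* A bound polynomial in the inverse of the subroutine accuracy is thereby polynomial in
   [accuracy_inv e]. *)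
have delV e : (del e)^-1 = (accuracy_inv e)%:R by rewrite /del fmorphV invrK rmorph_nat.
have alE e : ratr (1 + accuracy e) = 1 + del e by rewrite rmorphD rmorph1.
have al1 e : 1 <= 1 + accuracy e by rewrite lerDl; case/andP: (accuracy_itv e) => /ltW.
have acc1 e : 0 < e -> (1 + ratr (accuracy e)) * 1 <= 1 + e :> R.
  by move=> /accuracy_le; have := del0 e; rewrite /del; lra.
have acc2 e : 0 < e -> (1 + ratr (accuracy e)) * (1 + del e) <= 1 + e :> R.
  move=> /accuracy_le; have := del0 e; rewrite /del.
  have : ratr (accuracy e) < 1 :> R.
    by rewrite -(rmorph1 (@ratr R)) ltr_rat; case/andP: (accuracy_itv e).
  by nra.
have sal E : small E (@accuracy_inv R) (fun e => Num (1 + accuracy e)).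
  by apply: small_add; [exact: small_const | apply/small_inv/small_nat/pb_size].
have pinv E : poly_bounded E (fun p : R * data => accuracy_inv p.1 + dsize p.2)%N
    (fun p => accuracy_inv p.1).
  by apply: pb_le (pb_size _ _) => p _; apply: leq_addr.
have psize E : poly_bounded E (fun p : R * data => accuracy_inv p.1 + dsize p.2)%N
    (fun p => dsize p.2).
  by apply: pb_le (pb_size _ _) => p _; apply: leq_addl.
pose Dom (E : R -> Prop) (q : R * data) := E q.1 /\ nonparam_inputs P q.2.
split=> ALG.
(* With an exact subroutine [alpha] is 1, and the time bound of the subroutine is the same for every
   [e]. *)
- move=> [algP [p pP]]; have [T pT TP] := horner_bound p (psize (Dom (fun e => 0 < e))).
  have [||||Ggrid [k Gk]] := spec (fun e => 0 < e) (fun=> 1) (fun=> ALG) T _ _ _ pT _.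
  + by [].
  + exact: small_const.
  + by move=> e _; rewrite rmorph1.
  + move=> e v w t e0 vP rt; rewrite -(ler_nat R).
    exact: le_trans (pP _ _ _ vP rt) (TP (e, v) (conj e0 vP)).
  rewrite rmorph1 in Ggrid.
  eexists; eexists; split; first exact: Ggrid.
  split; last exact: polytime_family_exp Gk.
  move=> e e0; split; last exact: (@polytime_exp _ _ P _ k (accuracy_inv e) (fun I w t => Gk e I w t e0)).
  by have := is_grid_algorithm_approx ha hc (lexx _) (acc1 e e0) algP (Ggrid e e0).
- move=> [algP [p pP]]; have [T pT TP] := hornerXY_bound p (psize (Dom (fun e => 0 < e))) (pinv _).
  have [||||Ggrid [k Gk]] := spec (fun e => 0 < e) (fun e => 1 + accuracy e)
    (fun e => ALG (del e)) T _ _ _ pT _.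
  + by [].
  + exact: sal.
  + by move=> e _; rewrite alE; case: (algP _ (del0 e)).
  + move=> e v w t e0 vP rt; rewrite -(ler_nat R).
    apply: le_trans (TP (e, v) (conj e0 vP)); have := pP _ (del0 e) _ _ _ vP rt.
    by rewrite delV.
  exists (@accuracy R), del.
  eexists; split; first by move=> e e0; split=> //; rewrite -alE; apply: Ggrid.
  split; last exact: polytime_family_exp Gk.
  move=> e e0; split; last exact: (@polytime_exp _ _ P _ k (accuracy_inv e) (fun I w t => Gk e I w t e0)).
  have := Ggrid e e0; rewrite alE; apply: is_grid_algorithm_approx (acc2 e e0) _ => //.
    by rewrite lerDl ltW.
  by case: (algP _ (del0 e)).
- move=> algP.
  pose G e := grid_prog K (accuracy e) (1 + accuracy e) lmin_prog bounds_prog (ALG (del e)).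
  have main e : 0 < e ->
      is_grid_algorithm P lmin LB UB (accuracy e) (1 + del e) (ALG (del e)) (G e) /\
      polytime R (G e) (instance P).
    (* The polynomial bounding the time of [ALG (del e)] may vary with [e], so the specification is
       applied to this single [e]. *)
    move=> e0; have [algPe [p pP]] := algP _ (del0 e).
    have [T pT TP] := horner_bound p (psize (Dom (eq e))).
    have [||||Ggrid [k Gk]] := spec (eq e) (fun e => 1 + accuracy e)
      (fun e => ALG (del e)) T _ _ _ pT _.
    + by [].
    + exact: sal.
    + by move=> _ <-; rewrite alE.
    + move=> _ v w t <- vP rt; rewrite -(ler_nat R).
      exact: le_trans (pP _ _ _ vP rt) (TP (e, v) (conj erefl vP)).
    split; first by rewrite -alE; apply: Ggrid.
    exact: (@polytime_exp _ _ P _ k (accuracy_inv e) (fun I w t => Gk e I w t erefl)).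
  exists (@accuracy R), del, G.
  split=> [e e0|e e0]; first by split=> //; case: (main e e0).
  have [Ggrid Gtime] := main e e0; split=> //.
  apply: is_grid_algorithm_approx (acc2 e e0) _ Ggrid => //.
    by rewrite lerDl ltW.
  by case: (algP _ (del0 e)).
Qed.
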